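(* Let $d\ge1$ and let $\varphi_1,\varphi_2\in\mathcal{C}_0^\infty(\mathbb{R}^d)$ with $\varphi_1(0)=\varphi_2(0)=1$, $\varphi_1\ge0$, $\varphi_2\ge0$. Assume that for some $1\le p,q,r,s\le\infty$ and every $a\in W(L^p,L^q)(\mathbb{R}^{2d})$ the operator $A_a^{\varphi_1,\varphi_2}$ is bounded on $W(L^r,L^s)(\mathbb{R}^d)$. Then $$\frac1q\ge\left|\frac1r-\frac12\right|.$$
   Context: $\mathcal{C}_0^\infty$ denotes smooth compactly supported functions and $\mathcal{S}$ the Schwartz class. STFT: $V_\varphi f(x,\omega)=\int_{\mathbb{R}^d} f(t)\,\overline{\varphi(t-x)}\,e^{-2\pi i\omega t}\,dt$, $(x,\omega)\in\mathbb{R}^{2d}$. Localization operator: with $T_xf(t)=f(t-x)$, $M_\omega f(t)=e^{2\pi i\omega t}f(t)$, the operator with symbol $a$ and windows $\varphi_1,\varphi_2$ is formally $A_a^{\varphi_1,\varphi_2}f(t)=\int_{\mathbb{R}^{2d}}a(x,\omega)V_{\varphi_1}f(x,\omega)M_\omega T_x\varphi_2(t)\,dx\,d\omega$. It is interpreted weakly: $\langle A_a^{\varphi_1,\varphi_2}f,g\rangle=\int_{\mathbb{R}^{2d}}a(x,\omega)\,V_{\varphi_1}f(x,\omega)\,\overline{V_{\varphi_2}g(x,\omega)}\,dx\,d\omega$ for $f$ in the domain space and $g\in\mathcal{S}(\mathbb{R}^d)$ (the integral converges absolutely for the symbols, windows and functions considered here), where $\langle\cdot,\cdot\rangle$ extends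 the inner product $\langle f,g\rangle=\int f\bar g$ of $L^2$. Wiener amalgam space: $W(L^p,L^q)(\mathbb{R}^n)$ is the space of measurable functions $f$ on $\mathbb{R}^n$ with finite norm $\|f\|_{W(L^p,L^q)}=\Big(\sum_{k\in\mathbb{Z}^n}\|f\,\chi_{k+[0,1)^n}\|_{L^p}^q\Big)^{1/q}$ (supremum over $k$ if $q=\infty$). *)

(* Defs.v *)
From HB Require Import structures.
From mathcomp Require Import all_boot all_order all_algebra.
From mathcomp Require Import complex.
From mathcomp Require Import all_classical all_reals all_analysis.

Set Implicit Arguments.
Unset Strict Implicit.
Unset Printing Implicit Defensive.

Import Order.TTheory GRing.Theory Num.Theory.
Import numFieldNormedType.Exports.

Local Open Scope classical_set_scope.
Local Open Scope ring_scope.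
Local Open Scope complex_scope.

Section measurable_rV.
Context {R : realType} {n : nat}.

Definition rV_coord (i : 'I_n) (x : 'rV[R]_n) : R := x ord0 i.

Let rV_set0 : g_sigma_preimage rV_coord set0.
Proof. exact: sigma_algebra0. Qed.

Let rV_setC A : g_sigma_preimage rV_coord A -> g_sigma_preimage rV_coord (~` A).
Proof. exact: sigma_algebraC. Qed.

Let rV_bigcup (F : (set 'rV[R]_n)^nat) :
  (forall i, g_sigma_preimage rV_coord (F i)) ->
  g_sigma_preimage rV_coord (\bigcup_i (F i)).
Proof. exact: sigma_algebra_bigcup. Qed.

(* The sigma-algebra on R^n generated by the coordinates, i.e. the Borel one. *)
HB.instance Definition _ := @isMeasurable.Build default_measure_display
  'rV[R]_n (g_sigma_preimage rV_coord) rV_set0 rV_setC rV_bigcup.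

Lemma measurable_rV_coord i : measurable_fun [set: 'rV[R]_n] (rV_coord i).
Proof.
move=> _ Y mY; rewrite setTI; apply: sub_sigma_algebra => /=.
rewrite -bigcup_seq/=; exists i => /=; first by rewrite mem_index_enum.
by exists Y => //; rewrite setTI.
Qed.

Lemma measurable_fun_rV d (T : measurableType d) (f : T -> 'rV[R]_n) :
  (forall i, measurable_fun setT (rV_coord i \o f)) -> measurable_fun setT f.
Proof.
move=> fi; apply: (@measurability _ _ _ _ _ _ (\big[setU/set0]_(i < n)
    preimage_set_system setT (rV_coord i) measurable)) => //.
move=> _ [B + <-]; rewrite -bigcup_seq => -[i _ [A mA <-]].
rewrite !setTI -comp_preimage -[X in measurable X]setTI.
exact: fi.
Qed.

End measurable_rV.

Section lebesgue_rV.
Context {R : realType}.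
Local Open Scope ereal_scope.

Definition rV_cons n (p : measurableTypeR R * 'rV[R]_n) : 'rV[R]_n.+1 :=
  row_mx (p.1%:M : 'rV_1) p.2.

Definition rV_uncons n (x : 'rV[R]_n.+1) : measurableTypeR R * 'rV[R]_n :=
  (x ord0 ord0, @rsubmx _ 1 1 n x).

Lemma rV_consK n : cancel (@rV_cons n) (@rV_uncons n).
Proof.
move=> [a y]; rewrite /rV_uncons /rV_cons/= row_mxKr; congr (_, _).
have -> : (ord0 : 'I_n.+1) = lshift n (ord0 : 'I_1) by exact: ord_inj.
by rewrite [LHS](@row_mxEl _ 1 1 n) mxE eqxx mulr1n.
Qed.

Lemma measurable_rV_cons n : measurable_fun setT (@rV_cons n).
Proof.
apply: measurable_fun_rV => i; case: (splitP (i : 'I_(1 + n))) => j ij.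
  apply: (eq_measurable_fun fst) => // p _ /=.
  have -> : i = lshift n j by exact: ord_inj.
  by rewrite /rV_coord [RHS](@row_mxEl _ 1 1 n) mxE (ord1 j) eqxx mulr1n.
apply: (eq_measurable_fun (rV_coord j \o snd)) => [p _ /=|].
  have -> : i = rshift 1 j by exact: ord_inj.
  by rewrite /rV_coord [RHS](@row_mxEr _ 1 1 n).
exact: measurableT_comp (measurable_rV_coord j) measurable_snd.
Qed.

Lemma measurable_rV_uncons n : measurable_fun setT (@rV_uncons n).
Proof.
apply: measurable_fun_pair; first exact: (measurable_rV_coord (ord0 : 'I_n.+1)).
apply: measurable_fun_rV => i; rewrite /rV_coord /comp.
under eq_fun do rewrite mxE.
exact: (measurable_rV_coord (rshift 1 i : 'I_n.+1)).
Qed.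

Section cons_measure.
Context n (mu : {sigma_finite_measure set 'rV[R]_n -> \bar R}).

Definition cons_measure :=
  pushforward (@lebesgue_measure R \x mu) (@rV_cons n).

Let m0 : cons_measure set0 = 0.
Proof. by rewrite /cons_measure /pushforward preimage_set0 measure0. Qed.

Let m_ge0 A : 0 <= cons_measure A.
Proof.
apply: (@measure_ge0 _ _ _
  (pushforward (@lebesgue_measure R \x mu) (@rV_cons n))).
exact: measurable_rV_cons.
Qed.

Let m_sigma_additive : semi_sigma_additive cons_measure.
Proof.
apply: (@measure_semi_sigma_additive _ _ _
  (pushforward (@lebesgue_measure R \x mu) (@rV_cons n))).
exact: measurable_rV_cons.
Qed.

HB.instance Definition _ := isMeasure.Build _ _ _ cons_measure
  m0 m_ge0 m_sigma_additive.

Let m_sigma_finite : sigma_finite setT cons_measure.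
Proof.
have /sigma_finiteP[F [TF ndF Foo]] := sigma_finiteT (@lebesgue_measure R).
have /sigma_finiteP[G [TG ndG Goo]] := sigma_finiteT mu.
exists (fun k => @rV_uncons n @^-1` (F k `*` G k)).
  rewrite -preimage_bigcup -(preimage_setT (@rV_uncons n)); congr (_ @^-1` _).
  rewrite -setXTT TF TG predeqE => -[x y]; split => [|[k _ [/= ? ?]]].
    move=> [/= [k _ Fkx] [l _ Gly]]; exists (maxn k l) => //; split.
    - by move: x Fkx; exact/subsetPset/ndF/leq_maxl.
    - by move: y Gly; exact/subsetPset/ndG/leq_maxr.
  by split; exists k.
move=> k; have [mF Fk] := Foo k; have [mG Gk] := Goo k.
have mFG : measurable (F k `*` G k) by exact: measurableX.
split; first by rewrite -[X in measurable X]setTI; exact: measurable_rV_uncons.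
rewrite /cons_measure /pushforward -comp_preimage.
rewrite (_ : @rV_uncons n \o @rV_cons n = idfun); last first.
  by apply/funext => p; exact: rV_consK.
by rewrite preimage_id product_measure1E// lte_mul_pinfty// ge0_fin_numE.
Qed.

HB.instance Definition _ := Measure_isSigmaFinite.Build _ _ _ cons_measure
  m_sigma_finite.

End cons_measure.

(* Lebesgue measure on R^n, by iterated products along [rV_cons]; see
   [lebesgue_rV_box]. *)
Fixpoint lebesgue_rV n : {sigma_finite_measure set 'rV[R]_n -> \bar R} :=
  match n with
  | 0 => \d_(0%R : 'rV[R]_0)
  | n.+1 => cons_measure (lebesgue_rV n)
  end.

Lemma lebesgue_rV_box n (A : 'I_n -> set (measurableTypeR R)) :
  (forall i, measurable (A i)) ->
  lebesgue_rV n [set x | forall i, A i (x ord0 i)] =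
  \prod_(i < n) lebesgue_measure (A i).
Proof.
elim: n A => [|n IH] A mA.
  by rewrite big_ord0 /= diracE mem_set// => -[].
rewrite big_ord_recl -IH//= /cons_measure /pushforward -product_measure1E//=.
  congr (_ _); apply/seteqP; split => -[a y] /=; rewrite /rV_cons.
    move=> h; split.
      move: (h ord0).
      have -> : (ord0 : 'I_n.+1) = lshift n (ord0 : 'I_1) by exact: ord_inj.
      by rewrite [X in A _ X](@row_mxEl _ 1 1 n) mxE eqxx mulr1n.
    move=> i; move: (h (lift ord0 i)).
    have -> : lift ord0 i = rshift 1 i by exact: ord_inj.
    by rewrite [X in A _ X](@row_mxEr _ 1 1 n).
  move=> [h0 h] i; case: (splitP (i : 'I_(1 + n))) => j ij.
    have -> : i = lshift n j by exact: ord_inj.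
    rewrite [X in A _ X](@row_mxEl _ 1 1 n) mxE (ord1 j) eqxx mulr1n.
    by have <- : (ord0 : 'I_n.+1) = lshift n (ord0 : 'I_1) by exact: ord_inj.
  have -> : i = rshift 1 j by exact: ord_inj.
  rewrite [X in A _ X](@row_mxEr _ 1 1 n).
  by have <- : lift ord0 j = rshift 1 j by exact: ord_inj.
rewrite [X in measurable X](_ : _ = \bigcap_(i in [set: 'I_n])
    (rV_coord i @^-1` A (lift ord0 i))); last first.
  by apply/seteqP; split => x /= h i; [move=> _; exact: h|exact: (h i I)].
apply: fin_bigcap_measurable => [|i _]; first exact: finite_finset.
rewrite -[X in measurable X]setTI.
exact: (measurable_rV_coord i measurableT (mA _)).
Qed.

End lebesgue_rV.

Section definitions.
Context {R : realType}.
Local Notation C := R[i].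

Definition cmeasurable n (f : 'rV[R]_n -> C) :=
  measurable_fun setT (fun x => complex.Re (f x)) /\
  measurable_fun setT (fun x => complex.Im (f x)).

Definition cintegral n (f : 'rV[R]_n -> C) : C :=
  (\int[lebesgue_rV n]_x complex.Re (f x)) +i*
  (\int[lebesgue_rV n]_x complex.Im (f x)).

Definition dot n (x y : 'rV[R]_n) : R := \sum_(i < n) x ord0 i * y ord0 i.

Definition cis (t : R) : C := cos t +i* sin t.

Definition inner n (f g : 'rV[R]_n -> C) : C :=
  cintegral (fun t => f t * conjc (g t)).

Definition stft d (phi f : 'rV[R]_d -> C) (x w : 'rV[R]_d) : C :=
  cintegral (fun t => f t * conjc (phi (t - x)) * cis (- (2 * pi * dot w t))).

(* [partials [:: i1; ...; ik] f] is the iterated partial derivative of [f]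
   along the coordinates [i1], ..., [ik]. *)
Definition partials n (s : seq 'I_n) (f : 'rV[R]_n -> R) : 'rV[R]_n -> R :=
  foldr (fun i g => 'D_(delta_mx ord0 i) g) f s.

Definition smooth n (f : 'rV[R]_n -> R) :=
  forall s : seq 'I_n, continuous (partials s f) /\
    forall i x, derivable (partials s f) x (delta_mx ord0 i).

Definition schwartz n (f : 'rV[R]_n -> R) :=
  smooth f /\
  forall (s : seq 'I_n) (b : 'I_n -> nat), exists M : R, forall x : 'rV[R]_n,
    `|(\prod_(i < n) x ord0 i ^+ b i) * partials s f x| <= M.

Definition csmooth n (f : 'rV[R]_n -> C) :=
  smooth (fun x => complex.Re (f x)) /\ smooth (fun x => complex.Im (f x)).

Definition cschwartz n (f : 'rV[R]_n -> C) :=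
  schwartz (fun x => complex.Re (f x)) /\ schwartz (fun x => complex.Im (f x)).

Definition Cc_infty n (f : 'rV[R]_n -> C) :=
  csmooth f /\ compact (closure [set x | f x != 0]).

Definition unit_cube n (k : 'rV[int]_n) : set 'rV[R]_n :=
  [set x | forall i, (k ord0 i)%:~R <= x ord0 i < (k ord0 i)%:~R + 1].

Definition local_norm n (p : \bar R) (f : 'rV[R]_n -> C) (k : 'rV[int]_n)
    : \bar R :=
  Lnorm (lebesgue_rV n) p (fun x =>
    (ComplexField.Normc.normc (f x) * \1_(unit_cube k) x)%:E).

(* Exponents range over [1, +oo]; the value at [-oo] is irrelevant. *)
Definition amalgam_norm n (p q : \bar R) (f : 'rV[R]_n -> C) : \bar R :=
  match q with
  | q'%:E => ((\esum_(k in [set: 'rV[int]_n]) local_norm p f k `^ q')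
                `^ q'^-1)%E
  | +oo%E => ereal_sup (range (local_norm p f))
  | -oo%E => 0%E
  end.

Definition amalgam n (p q : \bar R) : set ('rV[R]_n -> C) :=
  [set f | cmeasurable f /\ (amalgam_norm p q f < +oo)%E].

Section localization_operator.
Context {d : nat} (phi1 phi2 : 'rV[R]_d -> C) (a : 'rV[R]_(d + d) -> C).

(* A point (x, w) of the phase space R^{2d} is the row vector [row_mx x w]. *)
Definition locop_form (f g : 'rV[R]_d -> C) : C :=
  cintegral (fun z => a z * stft phi1 f (lsubmx z) (rsubmx z) *
                      conjc (stft phi2 g (lsubmx z) (rsubmx z))).

(* The image of [f] under the localization operator is only defined weakly, as
   the function [h] (unique up to a null set) representing [locop_form f]. *)
Definition is_locop (f h : 'rV[R]_d -> C) :=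
  forall g, cschwartz g -> inner h g = locop_form f g.

Definition locop_bounded (r s : \bar R) :=
  exists2 c : R, 0 <= c & forall f, amalgam r s f ->
    exists h, [/\ amalgam r s h, is_locop f h &
      (amalgam_norm r s h <= c%:E * amalgam_norm r s f)%E].

End localization_operator.
End definitions.

(* Main.v *)
Require Import Defs.
From mathcomp Require Import all_boot all_order all_algebra.
From mathcomp Require Import complex.
From mathcomp Require Import all_classical all_reals all_analysis.
From mathcomp Require Import measurable_realfun ess_sup_inf.
From mathcomp Require Import ring lra.

(* The weak form of the operator at (f, g) is the integral of a V_phi1 f times the
   conjugate of V_phi2 g, so it suffices to make these integrals large compared with
   the norms of f, g and a.  Take N = 2^j and let the symbol have unimodular constant
   values gamma_l on the N unit cells at frequencies l e_1, 0 <= l < N.  One of the two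
   functions is a spike, a bump compressed by N in the first coordinate, whose transform
   has size 1/N and nearly constant phase at all these frequencies; the other is a fixed
   bump times a Rudin-Shapiro polynomial with coefficients gamma_l, of size sqrt N
   although its N frequencies all have coefficients of modulus 1.  Replacing gamma_l by
   gamma_l exp(2 pi i l k / N), in the symbol and in the polynomial at once, and averaging
   over k removes the off-diagonal terms of the form, so for some k the form is bounded
   below by a constant.  With the spike as f, boundedness would give
   1 <= C N^(1/q) N^(1/2) N^(-1/r); with the spike as g, 1 <= C N^(1/q) N^(1/2) N^(1/r - 1).
   To contradict boundedness for a single symbol, the blocks for j = 0, 1, ... are placed
   at well separated positions, where the compact supports make all interactions between
   different blocks vanish, with weights N^(-kappa), kappa slightly above 1/q. *)

(** Off-diagonal terms cannot be avoided: the test functions are compactly supported in time, so on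
    the frequency cell of [l] the transform of the polynomial still sees every frequency [m]. The
    averaging is free because a twist by a root of unity merely translates the polynomial, which
    keeps its sup bound, while the diagonal terms do not change. The diagonal terms are bounded
    below without asymptotics: all scales carry a factor [L] so large that every relevant phase is
    at most 1/4 on the support. There cosines are at least 1/2 and sines at most 1/4, so the product
    of one transform with the conjugate of the other has real part at least 1/4 - 1/16 = 3/16 of the
    product of the two masses. Symbols are constant on unit cells and [f], [g] lie in one common
    position cell. Inner norms of the symbol and outer norms of [f] thus reduce to single moduli and
    single local norms, which is why p and s are absent from the conclusion. *)

Set Implicit Arguments.
Unset Strict Implicit.
Unset Printing Implicit Defensive.

Import Order.TTheory GRing.Theory Num.Theory.
Import numFieldNormedType.Exports.

Local Open Scope classical_set_scope.
Local Open Scope ring_scope.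
Local Open Scope complex_scope.

(** * Smooth and Schwartz functions *)

Section smoothness.
Context {R : realType} {n : nat}.
Implicit Types (f g : 'rV[R]_n -> R) (s : seq 'I_n) (i : 'I_n).

Local Notation e i := (delta_mx ord0 i : 'rV[R]_n).

Lemma line_quotient f (x v : 'rV[R]_n) :
  (fun h : R => h^-1 *: ((f \o shift x) (h *: v) - f x)) =
  (fun h : R => h^-1 *: (((fun k : R => f (k *: v + x)) \o shift 0) (h *: 1)
     - (fun k : R => f (k *: v + x)) 0)).
Proof.
apply/funext => h; rewrite /= !addr0 scale0r add0r.
by rewrite [h *: 1]mulr1.
Qed.

(** Restricting to a line makes the one-variable chain rule [is_derive1_comp] available for
    directional derivatives. *)
Lemma is_derive_line f (x v : 'rV[R]_n) (df : R) :
  is_derive (0 : R) (1 : R) (fun k : R => f (k *: v + x)) df <->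
  is_derive x v f df.
Proof.
split=> -[H1 H2]; apply: DeriveDef.
- by rewrite /derivable line_quotient.
- by rewrite /derive line_quotient.
- by rewrite /derivable -line_quotient.
- by rewrite /derive -line_quotient.
Qed.

(** Grading by the order of differentiation gives an induction that the Leibniz and chain rules
    respect: the derivative is taken first, whereas [partials] adds it last. *)
Fixpoint smooth_upto (k : nat) f : Prop :=
  continuous f /\
  if k is k'.+1 then
    forall i, (forall x, derivable f x (e i)) /\ smooth_upto k' ('D_(e i) f)
  else True.

Lemma smooth_partial f i : smooth f -> smooth ('D_(e i) f).
Proof.
move=> sf s; have := sf (rcons s i).
by rewrite /partials foldr_rcons.
Qed.

Lemma smooth_upto_smooth f : smooth f <-> forall k, smooth_upto k f.
Proof.
split.
  move=> + k; elim: k f => [|k IH] f sf; first by split => //; exact: (sf [::]).1.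
  split; first exact: (sf [::]).1.
  move=> i; split; first by move=> x; exact: (sf [::]).2.
  exact/IH/smooth_partial.
move=> sf s.
have H : forall k, smooth_upto k (partials s f).
  elim: s => [//|i s IH] k /=.
  by have [_ /(_ i)[]] := IH k.+1.
split; first by have [] := H 0%N.
by move=> i x; have [_ /(_ i)[]] := H 1%N.
Qed.

Lemma smooth_uptoW k f : smooth_upto k.+1 f -> smooth_upto k f.
Proof.
elim: k f => [|k IH] f /= [cf sf]; split => // i.
by have [df sdf] := sf i; split => //; exact: IH.
Qed.

Lemma smooth_uptoD k f g : smooth_upto k f -> smooth_upto k g ->
  smooth_upto k (fun x => f x + g x).
Proof.
elim: k f g => [|k IH] f g /= [cf sf] [cg sg]; split => //;
  try by move=> x; apply: continuousD; [exact: cf|exact: cg].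
move=> i; have [df sdf] := sf i; have [dg sdg] := sg i; split.
  by move=> x; apply: derivableD.
rewrite (_ : 'D_(e i) _ = fun x => 'D_(e i) f x + 'D_(e i) g x); first exact: IH.
by apply/funext => x; rewrite -deriveD.
Qed.

Lemma smooth_uptoM k f g : smooth_upto k f -> smooth_upto k g ->
  smooth_upto k (fun x => f x * g x).
Proof.
elim: k f g => [|k IH] f g; first move=> [cf sf] [cg sg]; first split => //.
  by move=> x; apply: continuousM; [exact: cf|exact: cg].
move=> Sf Sg; have sf0 := smooth_uptoW Sf; have sg0 := smooth_uptoW Sg.
move: Sf Sg => [cf sf] [cg sg]; split.
  by move=> x; apply: continuousM; [exact: cf|exact: cg].
move=> i; have [df sdf] := sf i; have [dg sdg] := sg i; split.
  by move=> x; apply: derivableM.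
rewrite (_ : 'D_(e i) _ =
    fun x => f x * 'D_(e i) g x + g x * 'D_(e i) f x); last first.
  by apply/funext => x; exact: (deriveM (df x) (dg x)).
by apply: smooth_uptoD; exact: IH.
Qed.

Lemma smooth_upto_cst k (c : R) : smooth_upto k (fun=> c).
Proof.
have cc c' : continuous ((fun=> c') : 'rV[R]_n -> R) by exact: cst_continuous.
elim: k c => [|k IH] c /=; split => //.
move=> i; split; first by move=> x; exact: derivable_cst.
rewrite (_ : 'D_(e i) _ = fun=> 0 : R); first exact: IH.
by apply/funext => x; rewrite derive_cst.
Qed.

Lemma smoothD f g : smooth f -> smooth g -> smooth (fun x => f x + g x).
Proof.
move=> /smooth_upto_smooth sf /smooth_upto_smooth sg.
by apply/smooth_upto_smooth => k; exact: smooth_uptoD.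
Qed.

Lemma smoothM f g : smooth f -> smooth g -> smooth (fun x => f x * g x).
Proof.
move=> /smooth_upto_smooth sf /smooth_upto_smooth sg.
by apply/smooth_upto_smooth => k; exact: smooth_uptoM.
Qed.

Lemma smooth_cst (c : R) : smooth ((fun=> c) : 'rV[R]_n -> R).
Proof. by apply/smooth_upto_smooth => k; exact: smooth_upto_cst. Qed.

Lemma smooth_sum (I : Type) (r : seq I) (F : I -> 'rV[R]_n -> R) :
  (forall j, smooth (F j)) -> smooth (fun x => \sum_(j <- r) F j x).
Proof.
move=> sF; elim: r => [|j r IH].
  by under eq_fun do rewrite big_nil; exact: smooth_cst.
by under eq_fun do rewrite big_cons; exact: smoothD.
Qed.

Lemma rV_continuous (T : topologicalType) (F : T -> 'rV[R]_n) :
  (forall i, continuous (fun t => F t ord0 i)) -> continuous F.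
Proof.
move=> cF t A [P hP sub]; rewrite /nbhs /=.
have H : \forall u \near t, forall i, P ord0 i (F u ord0 i).
  by apply: filter_forall => i; apply: cF; exact: hP.
apply: filterS H => u Hu; apply: sub => i j; rewrite (ord1 i); exact: Hu.
Qed.

(** Writing -sin as a cosine advanced by [pi / 2] keeps the family closed under differentiation, so
    that smoothness follows by induction; sines are covered by a shift of [c]. *)
Lemma is_derive_cos_coord (i0 i : 'I_n) (b c : R) (x : 'rV[R]_n) :
  is_derive x (e i) (fun x => cos (b * x ord0 i0 + c))
    ((b *+ (i == i0)) * cos (b * x ord0 i0 + (c + pi / 2))).
Proof.
apply/is_derive_line.
pose l (k : R) := (b *+ (i == i0)) * k + (b * x ord0 i0 + c).
rewrite (_ : (fun k => _) = cos \o l); last first.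
  apply/funext => k; rewrite /l /= !mxE eqxx /= eq_sym.
  by case: (i == i0); rewrite ?mulr1n ?mulr0n; congr cos; ring.
rewrite addrA cosDpihalf mulrC.
have -> : b * x ord0 i0 + c = l 0 by rewrite /l mulr0 add0r.
apply: is_derive1_comp.
by rewrite /l; apply: is_derive_eq; rewrite ?addr0 ?mulr0 ?add0r /= [_ *: 1]mulr1.
Qed.

Lemma smooth_cos (i0 : 'I_n) (b c : R) : smooth (fun x => cos (b * x ord0 i0 + c)).
Proof.
have cc c' : continuous (fun x : 'rV[R]_n => cos (b * x ord0 i0 + c')).
  move=> x; apply: (@continuous_comp _ _ _ (fun x : 'rV[R]_n => b * x ord0 i0 + c') cos).
    apply: continuousD; last exact: cst_continuous.
    by apply: continuousM; [exact: cst_continuous|exact: coord_continuous].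
  exact: continuous_cos.
apply/smooth_upto_smooth => k; elim: k c => [|k IH] c /=; split => //.
move=> i; split; first by move=> x; have [] := is_derive_cos_coord i0 i b c x.
rewrite (_ : 'D_(e i) _ = fun x => (b *+ (i == i0)) *
    cos (b * x ord0 i0 + (c + pi / 2))); last first.
  by apply/funext => x; have [_ ->] := is_derive_cos_coord i0 i b c x.
by apply: smooth_uptoM; [exact: smooth_upto_cst|exact: IH].
Qed.

Definition rescale (s b : 'I_n -> R) (x : 'rV[R]_n) : 'rV[R]_n :=
  \row_i (s i * (x ord0 i - b i)).

Lemma continuous_rescale (s b : 'I_n -> R) : continuous (rescale s b).
Proof.
apply: rV_continuous => i; under eq_fun do rewrite mxE.
move=> x; apply: (@continuous_comp _ _ _ (fun x : 'rV[R]_n => x ord0 i)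
  (fun r => s i * (r - b i))) => [|/=]; first exact: coord_continuous.
by apply: cvgMr; apply: cvgB; [exact: cvg_id|exact: cvg_cst].
Qed.

Lemma is_derive_rescale (s b : 'I_n -> R) f i x : derivable f (rescale s b x) (e i) ->
  is_derive x (e i) (f \o rescale s b) (s i * 'D_(e i) f (rescale s b x)).
Proof.
move=> df; apply/is_derive_line.
set F := fun k : R => f (k *: e i + rescale s b x).
rewrite (_ : (fun k => _) = F \o (fun k => s i * k)); last first.
  apply/funext => k; rewrite /F /=; congr f; apply/rowP => j.
  rewrite !mxE eqxx /=; case: eqP => [->|_] /=; rewrite ?mulr1 ?mulr0; ring.
rewrite mulrC; apply: is_derive1_comp; last first.
  by apply: is_derive_eq; rewrite ?addr0 ?mulr0 ?add0r /= [_ *: 1]mulr1.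
by rewrite mulr0; apply/is_derive_line/derivableP.
Qed.

Lemma smooth_rescale (s b : 'I_n -> R) f : smooth f -> smooth (f \o rescale s b).
Proof.
move=> /smooth_upto_smooth sf; apply/smooth_upto_smooth => k.
elim: k f sf => [|k IH] f sf.
  split=> // x; apply: continuous_comp; first exact: continuous_rescale.
  by case: (sf 0%N) => + _; exact.
split.
  move=> x; apply: continuous_comp; first exact: continuous_rescale.
  by case: (sf 0%N) => + _; exact.
move=> i; have [_ /(_ i)[df _]] := sf 1%N; split.
  by move=> x; have [] := is_derive_rescale (df (rescale s b x)).
rewrite (_ : 'D_(e i) _ = fun x => s i * ('D_(e i) f \o rescale s b) x); last first.
  by apply/funext => x; have [_ ->] := is_derive_rescale (df (rescale s b x)).
apply: smooth_uptoM; first exact: smooth_upto_cst.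
apply: IH => k'; by have [_ /(_ i)[]] := sf k'.+1.
Qed.

(** The exterior region is open, so a function vanishing there is locally constant and its
    derivatives vanish there too. *)
Lemma partials_support0 (r : R) f s : (forall (x : 'rV[R]_n) i, r < `|x ord0 i| -> f x = 0) ->
  forall (x : 'rV[R]_n) i, r < `|x ord0 i| -> partials s f x = 0.
Proof.
move=> f0; elim: s => [//|j s IH] x i xi /=.
apply: derive_val.
have : \forall y \near x, partials s f y = 0.
  suff : nbhs x [set y : 'rV[R]_n | r < `|y ord0 i|] by apply: filterS => y; exact: IH.
  have := @continuous_comp _ _ _ (fun y : 'rV[R]_n => y ord0 i) Num.norm x
    (@coord_continuous _ _ _ _ _ _) (@norm_continuous _ _ _).
  by move=> /(_ [set z | r < z]); apply; apply: open_nbhs_nbhs; split => //; exact: open_gt.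

move=> near0; apply: (@near_eq_is_derive _ _ _ (cst 0)) => //.
by apply: filterS near0 => y /= ->.
Qed.

Lemma schwartz_compact (r : R) f :
  smooth f -> (forall (x : 'rV[R]_n) i, r < `|x ord0 i| -> f x = 0) -> schwartz f.
Proof.
move=> sf f0; split=> // s b.
have Kc : compact [set x : 'rV[R]_n | forall i, `[-r, r]%classic (x ord0 i)].
  by apply: (@rV_compact _ _ (fun=> `[-r, r]%classic)) => i; exact: segment_compact.
have /compact_bounded[M [_ HM]] :
    compact (partials s f @` [set x : 'rV[R]_n | forall i, `[-r, r]%classic (x ord0 i)]).
  by apply: continuous_compact => //; apply: continuous_subspaceT; exact: (sf s).1.
have M10 : 0 <= `|M| + 1 by rewrite addr_ge0.
have M1 : M < `|M| + 1 by rewrite ltr_pwDr// ler_norm.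
(* Inside the cube the monomial is bounded by powers of [r] and the derivative by compactness;
   outside the derivative is 0. [compact_bounded] bounds only by numbers strictly above [M], hence
   the [+ 1]. *)
exists (\prod_(i < n) `|r| ^+ b i * (`|M| + 1)) => x.
have [[i xi]|] := pselect (exists i, r < `|x ord0 i|).
  rewrite (partials_support0 s f0 xi) mulr0 normr0 mulr_ge0//.
  by apply: prodr_ge0 => j _; rewrite exprn_ge0.
move=> /forallNP xr.
have {}xr i : `|x ord0 i| <= r by rewrite leNgt; apply/negP; exact: xr.
rewrite normrM ler_pM//.
  rewrite normr_prod; apply: ler_prod => i _; rewrite normr_ge0 normrX lerXn2r//.
  exact: le_trans (xr i) (ler_norm r).
apply: (HM _ M1); exists x => // i /=.
by rewrite in_itv/= -ler_norml.
Qed.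

End smoothness.

(** * Unit cells and measurability *)

Section measurable_continuous.
Context {R : realType} {n : nat}.

Definition rV_floor (x : 'rV[R]_n) : 'rV[int]_n := \row_i Num.floor (x ord0 i).

Lemma unit_cubeE (k : 'rV[int]_n) : unit_cube k = rV_floor @^-1` [set k].
Proof.
apply/seteqP; split => x /=.
  by move=> kx; apply/rowP => i; rewrite mxE; apply/floor_def; rewrite intrD1; exact: kx.
move=> <- i; rewrite mxE; apply/andP; split; first exact: floor_le.
by rewrite -intrD1 floorD1_gt.
Qed.

Lemma measurable_coord_preimage i (A : set (measurableTypeR R)) : measurable A ->
  measurable [set x : 'rV[R]_n | A (x ord0 i)].
Proof.
by move=> mA; have := measurable_rV_coord i measurableT mA; rewrite setTI.
Qed.

Lemma measurable_box (A : 'I_n -> set (measurableTypeR R)) :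
  (forall i, measurable (A i)) ->
  measurable [set x : 'rV[R]_n | forall i, A i (x ord0 i)].
Proof.
move=> mA; rewrite (_ : [set _ | _] = \bigcap_(i in [set: 'I_n])
    [set x : 'rV[R]_n | A i (x ord0 i)]); last first.
  by apply/seteqP; split => x /= h i; [move=> _; exact: h|exact: (h i I)].
apply: fin_bigcap_measurable => [|i _]; first exact: finite_finset.
exact: measurable_coord_preimage.
Qed.

Lemma unit_cube_box (k : 'rV[int]_n) : unit_cube k =
  [set x : 'rV[R]_n | forall i, `[(k ord0 i)%:~R, (k ord0 i)%:~R + 1[%classic (x ord0 i)].
Proof. by apply/seteqP; split => x /= h i; have := h i; rewrite /= in_itv. Qed.

Lemma measurable_unit_cube (k : 'rV[int]_n) : measurable (@unit_cube R n k).
Proof.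
rewrite unit_cube_box.
apply: (@measurable_box (fun i => `[(k ord0 i)%:~R, (k ord0 i)%:~R + 1[%classic)) => i.
exact: measurable_itv.
Qed.

Lemma lebesgue_unit_cube (k : 'rV[int]_n) : lebesgue_rV n (@unit_cube R n k) = 1%E.
Proof.
rewrite unit_cube_box (@lebesgue_rV_box _ _ (fun i => `[(k ord0 i)%:~R, (k ord0 i)%:~R + 1[%classic));
  last by move=> i; exact: measurable_itv.
rewrite big1// => i _; rewrite lebesgue_measure_itv/= lte_fin ltrDl ltr01.
by rewrite -EFinB addrAC subrr add0r.
Qed.

(** Preimages are countable unions of unit cells. This serves both for the symbols and for the grid
    approximations of continuous functions. *)
Lemma measurable_floor_comp d' (T : measurableType d') (A : 'rV[int]_n -> T) :
  measurable_fun setT (A \o rV_floor).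
Proof.
move=> _ Y mY; rewrite setTI.
rewrite (_ : _ @^-1` _ = \bigcup_(k in A @^-1` Y) unit_cube k); last first.
  apply/seteqP; split => x /=.
    by move=> AY; exists (rV_floor x) => //; rewrite unit_cubeE.
  by move=> [k Yk]; rewrite unit_cubeE => /= ->.
rewrite bigcup_mkcond.
apply: (@countable_bigcupT_measurable _ _ 'rV[int]_n); first exact: countableP.
by move=> k; case: ifPn => // _; exact: measurable_unit_cube.
Qed.

(** The sigma-algebra is generated by coordinates and not by open sets, so [f] is obtained as the
    pointwise limit of its samples on the grids of mesh [1 / (k + 1)]. *)
Lemma continuous_rV_measurable (f : 'rV[R]_n -> R) :
  continuous f -> measurable_fun setT f.
Proof.
move=> cf.
pose g (k : nat) (m : 'rV[int]_n) := f (\row_i ((m ord0 i)%:~R / k.+1%:R)).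
pose h (k : nat) (x : 'rV[R]_n) := g k (rV_floor (k.+1%:R *: x)).
apply: (@measurable_fun_cvg _ _ _ _ h) => [k|x _].
  apply: (measurableT_comp (measurable_floor_comp (g k))).
  apply: measurable_fun_rV => i; rewrite /rV_coord /comp.
  under eq_fun do rewrite mxE.
  by apply: measurable_funM => //; exact: measurable_rV_coord.
apply: (@cvg_comp _ _ _ (fun k => \row_i ((rV_floor (k.+1%:R *: x) ord0 i)%:~R / k.+1%:R)) f _ (nbhs x));
  last exact: cf.
move=> A [P hP sub]; rewrite /nbhs /=.
suff H : forall i, (fun k : nat => (rV_floor (k.+1%:R *: x) ord0 i)%:~R / k.+1%:R : R) @ \oo --> x ord0 i.
  have : \forall k \near \oo, forall i, P ord0 i ((rV_floor (k.+1%:R *: x) ord0 i)%:~R / k.+1%:R).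
    by apply: filter_forall => i; apply: H; exact: hP.
  by apply: filterS => k Hk; apply: sub => i j; rewrite (ord1 i) mxE; exact: Hk.
move=> i; apply: (@squeeze_cvgr _ _ _ _ (fun k => x ord0 i - k.+1%:R^-1) (cst (x ord0 i))).
- near=> k; rewrite !mxE; apply/andP; split.
    rewrite ler_pdivlMr// mulrBl mulVf// mulrC lerBlDr.
    by rewrite -intrD1; apply/ltW; rewrite floorD1_gt.
  by rewrite ler_pdivrMr// mulrC; exact: floor_le.
- rewrite -[X in _ --> X]subr0; apply: cvgB; first exact: cvg_cst.
  exact: cvg_harmonic.
- exact: cvg_cst.
Unshelve. all: by end_near. Qed.

End measurable_continuous.

(** * Complex-valued integrals *)

Section complex_facts.
Context {R : realType}.
Local Notation C := R[i].
Local Notation normc := ComplexField.Normc.normc.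
Implicit Types (z w : C).

Lemma Re_addc z w : complex.Re (z + w) = complex.Re z + complex.Re w.
Proof. by case: z; case: w. Qed.

Lemma Im_addc z w : complex.Im (z + w) = complex.Im z + complex.Im w.
Proof. by case: z; case: w. Qed.

Lemma Re_mulc z w : complex.Re (z * w) =
  complex.Re z * complex.Re w - complex.Im z * complex.Im w.
Proof. by case: z => a b; case: w => c d; simpc. Qed.

Lemma Im_mulc z w : complex.Im (z * w) =
  complex.Re z * complex.Im w + complex.Im z * complex.Re w.
Proof. by case: z => a b; case: w => c d; simpc. Qed.

Lemma Re_real_mul (a : R) z : complex.Re (a%:C * z) = a * complex.Re z.
Proof. by case: z => x y; simpc. Qed.

Lemma Re_conjc z : complex.Re (conjc z) = complex.Re z.
Proof. by case: z. Qed.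

Lemma Im_conjc z : complex.Im (conjc z) = - complex.Im z.
Proof. by case: z. Qed.

Lemma conjc_mul z w : conjc (z * w) = conjc z * conjc w.
Proof. by case: z => a b; case: w => c d; simpc. Qed.

Lemma conjc_add z w : conjc (z + w) = conjc z + conjc w.
Proof. by case: z => a b; case: w => c d; simpc. Qed.

Lemma conjc_sum (I : Type) (r : seq I) (F : I -> C) :
  conjc (\sum_(j <- r) F j) = \sum_(j <- r) conjc (F j).
Proof. by elim/big_rec2 : _ => [|j a b _ <-]; rewrite ?conjc0 ?conjc_add. Qed.

Lemma normc_ge0 z : 0 <= normc z.
Proof. by case: z => a b; exact: sqrtr_ge0. Qed.

Lemma normr_Re_le z : `|complex.Re z| <= normc z.
Proof. by case: z => a b /=; rewrite -sqrtr_sqr ler_wsqrtr// lerDl sqr_ge0. Qed.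

Lemma normr_Im_le z : `|complex.Im z| <= normc z.
Proof. by case: z => a b /=; rewrite -sqrtr_sqr ler_wsqrtr// lerDr sqr_ge0. Qed.

Lemma normc_conjc z : normc (conjc z) = normc z.
Proof. by case: z => a b /=; rewrite sqrrN. Qed.

Lemma normc_real (a : R) : normc (a%:C) = `|a|.
Proof. by rewrite /= expr0n addr0 sqrtr_sqr. Qed.

Lemma sqr_normcE z : normc z ^+ 2 = complex.Re z ^+ 2 + complex.Im z ^+ 2.
Proof. by case: z => a b; rewrite sqr_sqrtr// addr_ge0// sqr_ge0. Qed.

Lemma mulc_conjc z : z * conjc z = (normc z ^+ 2)%:C.
Proof.
rewrite sqr_normcE; case: z => a b; apply/eqP.
by rewrite eq_complex /=; apply/andP; split; apply/eqP; ring.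
Qed.

Lemma Re_sum (I : Type) (r : seq I) (F : I -> C) :
  complex.Re (\sum_(j <- r) F j) = \sum_(j <- r) complex.Re (F j).
Proof. by elim/big_rec2 : _ => //= j a b _ <-; rewrite Re_addc. Qed.

Lemma Im_sum (I : Type) (r : seq I) (F : I -> C) :
  complex.Im (\sum_(j <- r) F j) = \sum_(j <- r) complex.Im (F j).
Proof. by elim/big_rec2 : _ => //= j a b _ <-; rewrite Im_addc. Qed.

Lemma cisD (a b : R) : cis (a + b) = cis a * cis b.
Proof. by rewrite /cis cosD sinD; simpc; congr (_ +i* _); rewrite addrC. Qed.

Lemma cis0 : cis (0 : R) = 1.
Proof. by rewrite /cis cos0 sin0. Qed.

Lemma conjc_cis (a : R) : conjc (cis a) = cis (- a).
Proof. by rewrite /cis /= cosN sinN. Qed.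

Lemma normc_cis (a : R) : normc (cis a) = 1.
Proof. by rewrite /= cos2Dsin2 sqrtr1. Qed.

Lemma cisM_nat (a : R) k : cis (a *+ k) = cis a ^+ k.
Proof. by elim: k => [|k IH]; rewrite ?mulr0n ?cis0// mulrS cisD IH exprS. Qed.

Lemma cis_2pi_nat k : cis (pi *+ 2 *+ k : R) = 1.
Proof. by rewrite cisM_nat /cis cos2pi sin2pi expr1n. Qed.

End complex_facts.

Section complex_measurable.
Context {R : realType} d (T : measurableType d).
Local Notation C := R[i].
Local Notation normc := ComplexField.Normc.normc.
Implicit Types f g : T -> C.

(* [cmeasurable] over an arbitrary measurable space; the two are convertible on
   ['rV[R]_n]. *)
Definition measurable_complex f :=
  measurable_fun setT (fun x => complex.Re (f x)) /\
  measurable_fun setT (fun x => complex.Im (f x)).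

Lemma measurable_complex_cst (c : C) : measurable_complex ((fun=> c) : T -> C).
Proof. by split; exact: measurable_cst. Qed.

Lemma measurable_complexM f g : measurable_complex f -> measurable_complex g ->
  measurable_complex (fun x => f x * g x).
Proof.
move=> [f1 f2] [g1 g2]; split.
  under eq_fun do rewrite Re_mulc.
  by apply: measurable_funB; exact: measurable_funM.
under eq_fun do rewrite Im_mulc.
by apply: measurable_funD; exact: measurable_funM.
Qed.

Lemma measurable_complex_conjc f : measurable_complex f -> measurable_complex (fun x => conjc (f x)).
Proof.
move=> [f1 f2]; split; first by under eq_fun do rewrite Re_conjc.
under eq_fun do rewrite Im_conjc.
exact: measurableT_comp f2.
Qed.

Lemma measurable_complex_real (h : T -> R) : measurable_fun setT h ->
  measurable_complex (fun x => (h x)%:C).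
Proof. by move=> mh; split => //; exact: measurable_cst. Qed.

Lemma measurable_complex_cis (h : T -> R) : measurable_fun setT h ->
  measurable_complex (fun x => cis (h x)).
Proof.
move=> mh; split => /=.
  by apply: measurableT_comp mh; apply: continuous_measurable_fun; exact: continuous_cos.
by apply: measurableT_comp mh; apply: continuous_measurable_fun; exact: continuous_sin.
Qed.

Lemma measurable_normc f : measurable_complex f -> measurable_fun setT (fun x => normc (f x)).
Proof.
move=> [f1 f2].
rewrite (_ : (fun x => _) = fun x => Num.sqrt (complex.Re (f x) ^+ 2 + complex.Im (f x) ^+ 2)).
  apply: (@measurableT_comp _ _ _ _ (measurableTypeR R) _ Num.sqrt).
    by apply: continuous_measurable_fun; exact: sqrt_continuous.
  by apply: measurable_funD; exact: measurable_funX.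
by apply/funext => x; rewrite -sqr_normcE sqrtr_sqr ger0_norm// normc_ge0.
Qed.

End complex_measurable.

Section complex_integrals.
Context {R : realType} {n : nat}.
Local Notation C := R[i].
Local Notation mu := (@lebesgue_rV R n).
Local Notation normc := ComplexField.Normc.normc.
Implicit Types f g : 'rV[R]_n -> C.

Lemma bounded_integrable (h : 'rV[R]_n -> R) (M : R) (D : set 'rV[R]_n) :
  measurable_fun setT h -> measurable D -> (mu D < +oo)%E ->
  (forall x, `|h x| <= M * \1_D x) -> mu.-integrable setT (EFin \o h).
Proof.
move=> mh mD Doo hM.
have M0 : 0 <= `|M| by [].
apply: (@le_integrable _ _ _ _ _ measurableT _ (EFin \o (fun x => `|M| * \1_D x))).
- exact/measurable_EFinP.
- move=> x _ /=; rewrite lee_fin (le_trans (hM x))//.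
  by rewrite (le_trans _ (ler_norm _))// ler_wpM2r// ler_norm.
- rewrite (_ : EFin \o _ = fun x => (`|M|%:E * (\1_D x)%:E)%E) //.
  apply: integrableZl => //; apply/integrableP; split.
    by apply/measurable_EFinP; exact: measurable_indic.
  under eq_integral do rewrite gee0_abs ?lee_fin//.
  by rewrite integral_indic// setIT.
Qed.

Definition cintegrable f :=
  mu.-integrable setT (EFin \o (fun x => complex.Re (f x))) /\
  mu.-integrable setT (EFin \o (fun x => complex.Im (f x))).

Lemma bounded_cintegrable f (M : R) (D : set 'rV[R]_n) :
  cmeasurable f -> measurable D -> (mu D < +oo)%E ->
  (forall x, normc (f x) <= M * \1_D x) -> cintegrable f.
Proof.
move=> [mf1 mf2] mD Doo fM; split; apply: (bounded_integrable (M := M) (D := D)) => // x.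
  exact: le_trans (normr_Re_le _) (fM x).
exact: le_trans (normr_Im_le _) (fM x).
Qed.

Lemma cintegral0 : cintegral ((fun=> 0) : 'rV[R]_n -> C) = 0.
Proof. by rewrite /cintegral /Rintegral /= integral0. Qed.

Lemma cintegrableD f g : cintegrable f -> cintegrable g ->
  cintegrable (fun x => f x + g x).
Proof.
move=> [f1 f2] [g1 g2]; split.
  apply: (eq_integrable measurableT _ _ _ (integrableD measurableT f1 g1)) => x _ /=.
  by rewrite Re_addc EFinD.
apply: (eq_integrable measurableT _ _ _ (integrableD measurableT f2 g2)) => x _ /=.
by rewrite Im_addc EFinD.
Qed.

Lemma cintegralD f g : cintegrable f -> cintegrable g ->
  cintegral (fun x => f x + g x) = cintegral f + cintegral g.
Proof.
move=> [f1 f2] [g1 g2]; rewrite /cintegral.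
under eq_Rintegral do rewrite Re_addc.
under [in X in _ +i* X]eq_Rintegral do rewrite Im_addc.
by rewrite !RintegralD//; simpc.
Qed.

Lemma cintegrableZ (c : C) f : cintegrable f -> cintegrable (fun x => c * f x).
Proof.
move=> [f1 f2]; split.
  apply: (eq_integrable measurableT _ _ _ (integrableB measurableT
    (integrableZl measurableT (complex.Re c) f1) (integrableZl measurableT (complex.Im c) f2))) => x _ /=.
  by rewrite Re_mulc EFinB !EFinM.
apply: (eq_integrable measurableT _ _ _ (integrableD measurableT
    (integrableZl measurableT (complex.Re c) f2) (integrableZl measurableT (complex.Im c) f1))) => x _ /=.
by rewrite Im_mulc EFinD !EFinM.
Qed.

Lemma cintegralZ (c : C) f : cintegrable f ->
  cintegral (fun x => c * f x) = c * cintegral f.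
Proof.
move=> [f1 f2]; rewrite /cintegral.
under eq_Rintegral do rewrite Re_mulc.
under [in X in _ +i* X]eq_Rintegral do rewrite Im_mulc.
have Z (r : R) (h : 'rV[R]_n -> R) : mu.-integrable setT (EFin \o h) ->
    mu.-integrable setT (EFin \o (fun x => r * h x)).
  by move=> ih; exact: (integrableZl measurableT r ih).
rewrite RintegralB ?RintegralD//; try exact: Z.
rewrite !RintegralZl//.
by case: c => a b /=; simpc.
Qed.

Lemma cintegrable_sum (I : Type) (r : seq I) (F : I -> 'rV[R]_n -> C) :
  (forall j, cintegrable (F j)) -> cintegrable (fun x => \sum_(j <- r) F j x).
Proof.
move=> iF; elim: r => [|j r IH].
  under eq_fun do rewrite big_nil.
  by split; exact: integrable0.
by under eq_fun do rewrite big_cons; exact: cintegrableD.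
Qed.

Lemma cintegral_sum (I : Type) (r : seq I) (F : I -> 'rV[R]_n -> C) :
  (forall j, cintegrable (F j)) ->
  cintegral (fun x => \sum_(j <- r) F j x) = \sum_(j <- r) cintegral (F j).
Proof.
move=> iF; elim: r => [|j r IH].
  by under eq_fun do rewrite big_nil; rewrite cintegral0 big_nil.
under eq_fun do rewrite big_cons; rewrite cintegralD//; last exact: cintegrable_sum.
by rewrite IH big_cons.
Qed.

End complex_integrals.

(** * Measurability of the short-time Fourier transform *)

Section parametric_integral.
Context {R : realType} {n : nat} d (T : measurableType d).
Local Notation mu := (@lebesgue_rV R n).

(** Tonelli is applied to the positive and negative parts in the extended reals, and [fine] is
    measurable, so the claim holds even where the inner integral diverges. *)
Lemma measurable_parametric_integral (f : T * 'rV[R]_n -> R) :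
  measurable_fun setT f ->
  measurable_fun setT (fun z => \int[mu]_t f (z, t)).
Proof.
move=> mf; rewrite /Rintegral.
apply: (@measurableT_comp _ _ _ _ _ _ fine); first exact: fine_measurable.
have -> : (fun z => \int[mu]_t (f (z, t))%:E)%E = (fun z =>
    \int[mu]_t ((EFin \o f)^\+%E (z, t)) - \int[mu]_t ((EFin \o f)^\-%E (z, t)))%E.
  by apply/funext => z; rewrite integralE; congr (_ - _)%E; apply: eq_integral => t _; rewrite ?funeposE ?funenegE.
have mEf : measurable_fun setT (EFin \o f) by exact/measurable_EFinP.
apply: emeasurable_funB.
- apply: (@measurable_fun_fubini_tonelli_F _ _ T 'rV[R]_n R mu (EFin \o f)^\+%E) => //.
  exact: measurable_funepos.
- apply: (@measurable_fun_fubini_tonelli_F _ _ T 'rV[R]_n R mu (EFin \o f)^\-%E) => //.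
  exact: measurable_funeneg.
Qed.

End parametric_integral.

Section stft_measurable.
Context {R : realType} {d : nat}.
Local Notation C := R[i].

Lemma measurable_dot dd (T : measurableType dd) (f g : T -> 'rV[R]_d) :
  (forall i, measurable_fun setT (fun x => f x ord0 i)) ->
  (forall i, measurable_fun setT (fun x => g x ord0 i)) ->
  measurable_fun setT (fun x => dot (f x) (g x)).
Proof.
by move=> mf mg; apply: measurable_sum => i; exact: measurable_funM.
Qed.

Lemma cmeasurable_stft (phi f : 'rV[R]_d -> C) :
  cmeasurable phi -> cmeasurable f ->
  cmeasurable (fun z : 'rV[R]_(d + d) => stft phi f (lsubmx z) (rsubmx z)).
Proof.
move=> mphi mf.
have mfst i : measurable_fun setT (fun p : 'rV[R]_(d + d) * 'rV[R]_d => p.1 ord0 i).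
  by apply: (measurableT_comp (measurable_rV_coord i)); exact: measurable_fst.
have msnd i : measurable_fun setT (fun p : 'rV[R]_(d + d) * 'rV[R]_d => p.2 ord0 i).
  by apply: (measurableT_comp (measurable_rV_coord i)); exact: measurable_snd.
have mI : measurable_complex (fun p : 'rV[R]_(d + d) * 'rV[R]_d =>
    f p.2 * conjc (phi (p.2 - lsubmx p.1)) * cis (- (2 * pi * dot (rsubmx p.1) p.2))).
  apply: measurable_complexM; first apply: measurable_complexM.
  - by split; [exact: (measurableT_comp mf.1 measurable_snd)|
               exact: (measurableT_comp mf.2 measurable_snd)].
  - apply: measurable_complex_conjc.
    have mdiff : measurable_fun setT
        (fun p : 'rV[R]_(d + d) * 'rV[R]_d => p.2 - lsubmx p.1).
      apply: measurable_fun_rV => i; rewrite /rV_coord /comp.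
      under eq_fun do rewrite !mxE.
      exact: measurable_funB.
    by split; [exact: (measurableT_comp mphi.1 mdiff)|
               exact: (measurableT_comp mphi.2 mdiff)].
  - apply: measurable_complex_cis; apply: measurableT_comp => //.
    apply: measurable_funM => //; apply: measurable_dot => i //=.
    by apply: eq_measurable_fun (mfst (rshift d i)) => p _; rewrite mxE.
by split; [exact: measurable_parametric_integral mI.1|
           exact: measurable_parametric_integral mI.2].
Qed.

End stft_measurable.

(** * Volumes of boxes *)

Section box_volume.
Context {R : realType} {n : nat}.
Local Notation mu := (@lebesgue_rV R n).

Definition centered_box (b r : 'I_n -> R) : set 'rV[R]_n :=
  [set x | forall i, `|x ord0 i - b i| <= r i].

Lemma centered_boxE (b r : 'I_n -> R) : centered_box b r =
  [set x | forall i, `[b i - r i, b i + r i]%classic (x ord0 i)].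
Proof.
by apply/seteqP; split => x /= h i; have := h i; rewrite /= in_itv/= ler_distl.
Qed.

Lemma measurable_centered_box (b r : 'I_n -> R) : measurable (centered_box b r).
Proof.
rewrite centered_boxE.
by apply: (@measurable_box _ _ (fun i => `[b i - r i, b i + r i]%classic)) => i; exact: measurable_itv.
Qed.

Lemma lebesgue_centered_box (b r : 'I_n -> R) : (forall i, 0 <= r i) ->
  mu (centered_box b r) = (\prod_(i < n) (2 * r i))%:E.
Proof.
move=> r0; rewrite centered_boxE
  (@lebesgue_rV_box _ _ (fun i => `[b i - r i, b i + r i]%classic)); last first.
  by move=> i; exact: measurable_itv.
rewrite -prodEFin; apply: eq_bigr => i _.
rewrite lebesgue_measure_itv/= lte_fin; case: ltP => h.
  by rewrite -EFinB; congr _%:E; ring.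
have -> : r i = 0 by have := r0 i; lra.
by rewrite mulr0.
Qed.

End box_volume.

(** * Lebesgue norms of functions on sets of finite measure *)

Section Lnorm_bounds.
Context {R : realType} d (T : measurableType d) (mu : {measure set T -> \bar R}).
Implicit Types (f h : T -> R) (p : \bar R) (B : set T).

(** The real number [fine p^-1] is the reciprocal exponent, with value 0 at infinity; it lets finite
    and infinite exponents share one statement. *)
Lemma exponentP p : (1 <= p)%E ->
  (p = +oo%E /\ fine p^-1%E = 0) \/
  exists2 r : R, 1 <= r & p = r%:E /\ fine p^-1%E = r^-1.
Proof.
case: p => [r| |] //; last by left; rewrite invey.
rewrite lee_fin => r1; right; exists r => //; split => //.
by rewrite inver gt_eqF// (lt_le_trans _ r1).
Qed.

Lemma Lnorm_le_bounded p f B (M V : R) : (1 <= p)%E ->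
  measurable_fun setT f -> measurable B -> mu B = V%:E -> 0 <= M ->
  (forall x, `|f x| <= M * \1_B x) ->
  ('N[mu]_p[EFin \o f] <= (M * V `^ fine p^-1%E)%:E)%E.
Proof.
move=> p1 mf mB BV M0 fM.
have V0 : 0 <= V by rewrite -lee_fin -BV.
case: (exponentP p1) => [[-> ->]|[r r1 [-> ->]]].
  rewrite powRr0 mulr1 unlock; case: ifPn => // _; apply/ess_supP.
  apply: nearW => x /=; rewrite lee_fin (le_trans (fM x))//.
  by rewrite indicE ler_piMr// lern1; case: (_ \in _).
have r0 : 0 < r by rewrite (lt_le_trans _ r1).
have rN0 : r != 0 by rewrite gt_eqF.
rewrite unlock.
have -> : (M * V `^ r^-1)%:E = (((M `^ r)%:E * V%:E) `^ r^-1)%E.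
  rewrite -EFinM poweR_EFin powRM ?powR_ge0//.
  by rewrite -powRrM divff// powRr1.
apply: gt0_ler_poweR; rewrite ?invr_ge0 ?(ltW r0)//.
- by rewrite in_itv/= leey andbT integral_ge0// => x _; exact: poweR_ge0.
- by rewrite in_itv/= leey andbT -EFinM lee_fin mulr_ge0// powR_ge0.
rewrite -BV -[B in mu B]setIT -integral_indic// -ge0_integralZl//;
  try (by apply/measurable_EFinP; exact: measurable_indic);
  try (by rewrite lee_fin powR_ge0).
apply: ge0_le_integral => //.
- by move=> x _; exact: poweR_ge0.
- apply: (@measurableT_comp _ _ _ _ _ _ (fun x : \bar R => x `^ r)%E); first exact: measurable_poweR.
  by apply/measurable_EFinP; exact: measurableT_comp.
- by apply: measurable_funeM; apply/measurable_EFinP; exact: measurable_indic.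
- move=> x _ /=; rewrite -EFinM lee_fin.
  have := fM x; rewrite indicE; case: (_ \in _) => /=; rewrite ?mulr1 ?mulr0 => h.
    by apply: ge0_ler_powR; rewrite ?nnegrE// ltW.
  by move: h; rewrite normr_le0 => /eqP ->; rewrite normr0 powR0.
Qed.

(** Hoelder's inequality against the indicator of [B], whose norm at the conjugate exponent is [V]
    to the power 1 - 1/p. *)
Lemma integral_indic_le_Lnorm p h B (V : R) : (1 <= p)%E ->
  measurable_fun setT h -> measurable B -> mu B = V%:E ->
  (\int[mu]_x (`|h x| * \1_B x)%:E <=
    'N[mu]_p[EFin \o h] * (V `^ (1 - fine p^-1%E))%:E)%E.
Proof.
move=> p1 mh mB BV.
have V0 : 0 <= V by rewrite -lee_fin -BV.
have mi : measurable_fun setT (\1_B : T -> R) by exact: measurable_indic.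
have i01 x : 0 <= (\1_B x : R) <= 1.
  by rewrite indicE; case: (_ \in _) => /=; rewrite ?lexx ?ler01.
have mprod : measurable_fun setT (fun x => (`|h x| * \1_B x)%:E).
  by apply/measurable_EFinP; apply: measurable_funM => //; exact: measurableT_comp.
have ge0 x : (0 <= (`|h x| * \1_B x)%:E)%E.
  by rewrite lee_fin mulr_ge0//; case/andP: (i01 x).
case: (exponentP p1) => [[-> ->]|[r r1 [-> ->]]].
  rewrite subr0 powRr1// -BV -[B in mu B]setIT -integral_indic//.
  (* On a space of measure zero the norm at infinite exponent is 0 by definition, not an essential
     supremum. *)
  have [muT0|] := eqVneq (mu setT) 0%E.
    rewrite (_ : (\int[mu]_x _)%E = 0%E); last first.
      apply: null_set_integral => //.
    by rewrite mule_ge0 ?Lnorm_ge0// integral_ge0// => x _; rewrite lee_fin; case/andP: (i01 x).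
  move=> muT; rewrite unlock lt0e muT measure_ge0/=.
  set S := ess_sup _ _.
  have S0 : (0 <= S)%E by apply: ess_sup_gee => //; rewrite ?lt0e ?muT ?measure_ge0//; apply: nearW => x /=.
  rewrite -ge0_integralZl//; last exact/measurable_EFinP.
  apply: ae_ge0_le_integral => //.
  - by move=> x _; rewrite mule_ge0// lee_fin; case/andP: (i01 x).
  - by apply: emeasurable_funM => //; exact/measurable_EFinP.
  apply: filterS (ess_sup_ge mu (abse \o (EFin \o h))) => x hx _.
  by rewrite EFinM lee_wpmul2r// lee_fin; case/andP: (i01 x).
(* At [r = 1] the conjugate exponent is infinite, so Hoelder with two finite exponents does not
   cover this case; the bound is then immediate. *)
have [rE|r1'] := eqVneq r 1.
  rewrite rE invr1 subrr powRr0 mule1 Lnorm1; apply: ge0_le_integral => //.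
  - by apply/measurable_EFinP; exact: measurableT_comp.
  - move=> x _ /=; rewrite lee_fin ler_piMr//; by case/andP: (i01 x).
have r0 : 0 < r by rewrite (lt_le_trans _ r1).
have {}r1 : 1 < r by rewrite lt_neqAle eq_sym r1'.
have q0 : 0 < 1 - r^-1 by rewrite subr_gt0 invf_lt1.
have := @hoelder _ _ _ mu h \1_B r (1 - r^-1)^-1 mh mi r0.
rewrite invr_gt0 invrK addrCA subrr addr0 => /(_ q0 erefl).
rewrite Lnorm1 => H.
apply: (@le_trans _ _ (\int[mu]_x `|(EFin \o (h \* \1_B)%R) x|)%E).
  by apply: ge0_le_integral => //;
    [apply/measurable_EFinP; apply: measurableT_comp => //; exact: measurable_funM |
     move=> x _ /=; rewrite lee_fin normrM ler_wpM2l// ler_norm].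
apply: (le_trans H); rewrite lee_wpmul2l ?Lnorm_ge0//.
have := @Lnorm_le_bounded ((1 - r^-1)^-1)%:E \1_B B 1 V.
rewrite lee_fin invf_ge1// lerBlDr lerDl invr_ge0 (ltW r0) mul1r inver invr_eq0 gt_eqF//= invrK.
apply => // x; first by rewrite mul1r ger0_norm//; case/andP: (i01 x).
Qed.

End Lnorm_bounds.

(** * Amalgam norms *)

Section amalgam_norms.
Context {R : realType} {n : nat}.
Local Notation C := R[i].
Local Notation mu := (@lebesgue_rV R n).
Local Notation normc := ComplexField.Normc.normc.
Implicit Types (f h : 'rV[R]_n -> C) (p r s : \bar R) (k : 'rV[int]_n).

Lemma local_norm_ge0 r f k : (0 <= local_norm r f k)%E.
Proof. exact: Lnorm_ge0. Qed.

Lemma local_norm_eq0 r f k : (1 <= r)%E ->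
  (forall x, unit_cube k x -> f x = 0) -> local_norm r f k = 0%E.
Proof.
move=> r1 f0; rewrite /local_norm (_ : (fun x => _) = cst 0%E).
  by rewrite Lnorm0// gt_eqF// (lt_le_trans _ r1).
apply/funext => x /=; rewrite indicE; have [xk|] := boolP (x \in _).
  by rewrite f0 ?ComplexField.Normc.normc0 ?mul0r//; rewrite inE in xk.
by rewrite mulr0.
Qed.

Lemma local_norm_le_amalgam r s h k : (1 <= s)%E ->
  (local_norm r h k <= amalgam_norm r s h)%E.
Proof.
case: s => [s| |] //; rewrite ?lee_fin => s1; last first.
  by apply: ereal_sup_ubound; exists k.
have s0 : 0 < s by rewrite (lt_le_trans _ s1).
rewrite /amalgam_norm -[leLHS](@poweRe1 R)// ?local_norm_ge0//.
rewrite -(divff (lt0r_neq0 s0)) poweRrM; apply: gt0_ler_poweR.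
- by rewrite invr_ge0 ltW.
- by rewrite in_itv/= leey poweR_ge0.
- by rewrite in_itv/= leey andbT esum_ge0// => *; exact: poweR_ge0.
- apply: esum_ge; exists [set k]; first by split.
  by rewrite fsbig_set1.
Qed.

(** The outer norm has a single nonzero term. Every test function is of this kind, so its amalgam
    norm is controlled by one local norm. *)
Lemma amalgam_norm_single r s f k : (1 <= r)%E -> (1 <= s)%E ->
  (forall x, ~ unit_cube k x -> f x = 0) ->
  (amalgam_norm r s f <= local_norm r f k)%E.
Proof.
move=> r1 s1 f0.
have fk k' : k' != k -> local_norm r f k' = 0%E.
  move=> kk; apply: local_norm_eq0 => // x; rewrite unit_cubeE => /= xk'.
  by apply: f0; rewrite unit_cubeE /= xk'; exact/eqP.
case: s s1 => [s| |] //; rewrite ?lee_fin => s1; last first.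
  apply: ge_ereal_sup => _ [k' _ <-].
  by have [->//|/fk ->] := eqVneq k' k; exact: local_norm_ge0.
have s0 : 0 < s by rewrite (lt_le_trans _ s1).
rewrite /amalgam_norm (esumID [set k]); last by move=> *; exact: poweR_ge0.
rewrite [X in (_ + X)%E]esum1 ?adde0; last first.
  by move=> k' /= [_ /eqP/fk ->]; rewrite poweR0r// gt_eqF.
rewrite setTI esum_set1 ?poweR_ge0// -poweRrM divff ?gt_eqF//.
by rewrite poweRe1// local_norm_ge0.
Qed.

Lemma local_norm_le_bounded r f k (B : set 'rV[R]_n) (M V : R) : (1 <= r)%E ->
  cmeasurable f -> measurable B -> mu B = V%:E -> 0 <= M ->
  (forall x, normc (f x) <= M * \1_B x) ->
  (local_norm r f k <= (M * V `^ fine r^-1%E)%:E)%E.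
Proof.
move=> r1 mf mB BV M0 fM; rewrite /local_norm.
apply: (@Lnorm_le_bounded _ _ _ _ r (fun x => normc (f x) * \1_(unit_cube k) x) B) => //.
  apply: measurable_funM; first exact: measurable_normc.
  by apply: measurable_indic; exact: measurable_unit_cube.
move=> x; rewrite normrM ger0_norm ?normc_ge0// (le_trans _ (fM x))//.
by rewrite ler_piMr ?normc_ge0// indicE normr_nat lern1; case: (_ \in _).
Qed.

(** Duality on one cell: [g] is charged at the exponent conjugate to [r], and only the part of [h]
    on the cell [k] matters. *)
Lemma Re_inner_le r h g k (B : set 'rV[R]_n) (M V : R) : (1 <= r)%E ->
  cmeasurable h -> cmeasurable g -> measurable B -> mu B = V%:E -> 0 <= M ->
  B `<=` unit_cube k -> (forall x, normc (g x) <= M * \1_B x) ->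
  (local_norm r h k < +oo)%E ->
  ((complex.Re (inner h g))%:E <=
     (M * V `^ (1 - fine r^-1%E))%:E * local_norm r h k)%E.
Proof.
move=> r1 mh mg mB BV M0 Bk gM hoo.
pose H x := normc (h x) * \1_(unit_cube k) x.
have mH : measurable_fun setT H.
  apply: measurable_funM; first exact: measurable_normc.
  by apply: measurable_indic; exact: measurable_unit_cube.
have HB : (\int[mu]_x (`|H x| * \1_B x)%:E <=
    local_norm r h k * (V `^ (1 - fine r^-1%E))%:E)%E.
  exact: integral_indic_le_Lnorm.
pose F x := complex.Re (h x * conjc (g x)).
have mF : measurable_fun setT F.
  by have [] := @measurable_complexM _ _ _ _ _ mh (measurable_complex_conjc mg).
have FH x : `|F x| <= M * (`|H x| * \1_B x).
  rewrite (le_trans (normr_Re_le _))// ComplexField.Normc.normcM normc_conjc.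
  have [Bx|Bx] := boolP (x \in B).
    have := gM x; rewrite /H !indicE Bx !mulr1 mem_set; last first.
      by apply: Bk; rewrite inE in Bx.
    by rewrite mulr1 ger0_norm ?normc_ge0// mulrC => g1; rewrite ler_wpM2r// normc_ge0.
  have := gM x; rewrite !indicE (negbTE Bx) !mulr0 => g0.
  by rewrite mulr_ge0_le0// normc_ge0.
have mHB : measurable_fun setT (fun x => (`|H x| * \1_B x)%:E).
  apply/measurable_EFinP; apply: measurable_funM; first exact: measurableT_comp.
  exact: measurable_indic.
have HB0 x : (0 <= (`|H x| * \1_B x)%:E)%E.
  by rewrite lee_fin mulr_ge0// indicE; case: (_ \in _).
have IF : (\int[mu]_x `|(F x)%:E| <=
    (M * V `^ (1 - fine r^-1%E))%:E * local_norm r h k)%E.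
  apply: (@le_trans _ _ (\int[mu]_x (M%:E * (`|H x| * \1_B x)%:E))%E).
    apply: ge0_le_integral => //.
    - by apply/measurable_EFinP; exact: measurableT_comp.
    - exact: measurable_funeM.
    - by move=> x _; rewrite /= -EFinM lee_fin.
  by rewrite ge0_integralZl// EFinM -muleA lee_wpmul2l ?lee_fin// muleC.
(* Integrability excludes the default value that [fine] gives to an infinite integral. *)
have iF : mu.-integrable setT (EFin \o F).
  apply/integrableP; split; first exact/measurable_EFinP.
  apply: (le_lt_trans IF); rewrite lte_mul_pinfty ?lee_fin ?mulr_ge0 ?powR_ge0//.
apply: le_trans IF; rewrite /inner /= /Rintegral fineK; last exact: integrable_fin_num.
by apply: (le_trans (lee_abs _)); apply: le_abse_integral => //; exact/measurable_EFinP.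
Qed.

Lemma cmeasurable_cellwise (A : 'rV[int]_n -> C) : cmeasurable (A \o @rV_floor R n).
Proof.
split; first exact: (measurable_floor_comp (fun k => complex.Re (A k))).
exact: (measurable_floor_comp (fun k => complex.Im (A k))).
Qed.

(** Cells have volume 1, so the bound is the same for all [p]. *)
Lemma local_norm_cellwise p (A : 'rV[int]_n -> C) k : (1 <= p)%E ->
  (local_norm p (A \o @rV_floor R n) k <= (normc (A k))%:E)%E.
Proof.
move=> p1; rewrite /local_norm.
have := @Lnorm_le_bounded _ _ _ mu p
  (fun x => normc ((A \o @rV_floor R n) x) * \1_(unit_cube k) x) (unit_cube k) (normc (A k)) 1 p1.
rewrite powR1 mulr1; apply.
- apply: measurable_funM; first exact/measurable_normc/cmeasurable_cellwise.
  by apply: measurable_indic; exact: measurable_unit_cube.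
- exact: measurable_unit_cube.
- exact: lebesgue_unit_cube.
- exact: normc_ge0.
- move=> x; rewrite indicE; have [|] := boolP (x \in _); last by rewrite !mulr0 normr0.
  by rewrite inE unit_cubeE /= => ->; rewrite !mulr1 ger0_norm// normc_ge0.
Qed.

Lemma amalgam_cellwise_oo p (A : 'rV[int]_n -> C) (M : R) : (1 <= p)%E ->
  (forall k, normc (A k) <= M) -> amalgam p +oo%E (A \o @rV_floor R n).
Proof.
move=> p1 AM; split; first exact: cmeasurable_cellwise.
apply: (@le_lt_trans _ _ M%:E); last exact: ltry.
apply: ge_ereal_sup => _ [k _ <-].
by rewrite (le_trans (local_norm_cellwise _ _ p1))// lee_fin.
Qed.

Lemma amalgam_cellwise_fin p (q : R) (A : 'rV[int]_n -> C) : (1 <= p)%E -> 1 <= q ->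
  (\esum_(k in [set: 'rV[int]_n]) ((normc (A k)) `^ q)%:E < +oo)%E ->
  amalgam p q%:E (A \o @rV_floor R n).
Proof.
move=> p1 q1 Aoo; split; first exact: cmeasurable_cellwise.
have q0 : 0 < q by rewrite (lt_le_trans _ q1).
apply: poweR_lty; apply: le_lt_trans Aoo; apply: le_esum => k _.
rewrite -poweR_EFin; apply: gt0_ler_poweR; rewrite ?(ltW q0)//.
- by rewrite in_itv/= leey local_norm_ge0.
- by rewrite in_itv/= leey lee_fin normc_ge0.
- exact: local_norm_cellwise.
Qed.

End amalgam_norms.

(** * Rudin-Shapiro polynomials *)

Section rudin_shapiro.
Context {R : realType}.
Local Notation C := R[i].
Local Notation normc := ComplexField.Normc.normc.

Definition trig_sum (N : nat) (c : nat -> C) (y : R) : C :=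
  \sum_(m < N) c m * cis (m%:R * y).

Lemma normc_parallelogram (z w : C) :
  normc (z + w) ^+ 2 + normc (z - w) ^+ 2 = 2 * (normc z ^+ 2 + normc w ^+ 2).
Proof. by rewrite !sqr_normcE; case: z => a b; case: w => c e /=; ring. Qed.

(** The recursion sends (P, Q) to (P + zQ, P - zQ) with z = [cis (2^k y)]. By the parallelogram law
    the sum of squared moduli doubles at each step, starting from 2. *)
Lemma rudin_shapiro_pair k : exists a b : nat -> R,
  [/\ forall m, a m ^+ 2 = 1, forall m, b m ^+ 2 = 1 &
   forall y, normc (trig_sum (2 ^ k) (fun m => (a m)%:C) y) ^+ 2 +
     normc (trig_sum (2 ^ k) (fun m => (b m)%:C) y) ^+ 2 = 2 ^+ k.+1].
Proof.
elim: k => [|k [a [b [a1 b1 ab]]]].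
  exists (fun=> 1), (fun=> 1); split => [m|m|y]; rewrite ?expr1n//.
  by rewrite /trig_sum big_ord1 mul0r cis0 mulr1 normc_real normr1 expr1n expr1.
exists (fun m => if (m < 2 ^ k)%N then a m else b (m - 2 ^ k)%N),
  (fun m => if (m < 2 ^ k)%N then a m else - b (m - 2 ^ k)%N); split.
- by move=> m; case: ifP.
- by move=> m; case: ifP; rewrite ?sqrrN.
move=> y.
(* Both members of the new pair at once: [s] is 1 or -1. *)
have E (s : R) : trig_sum (2 ^ k.+1)
    (fun m => (if (m < 2 ^ k)%N then a m else s * b (m - 2 ^ k)%N)%:C) y =
    trig_sum (2 ^ k) (fun m => (a m)%:C) y +
    s%:C * (cis ((2 ^ k)%:R * y) * trig_sum (2 ^ k) (fun m => (b m)%:C) y).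
  rewrite /trig_sum expnS mul2n -addnn big_split_ord /=; congr (_ + _).
    by apply: eq_bigr => i _; rewrite ltn_ord.
  rewrite !mulr_sumr; apply: eq_bigr => i _.
  rewrite ltnNge leq_addr /= addKn natrD mulrDl cisD rmorphM /=.
  by rewrite mulrACA !mulrA; congr (_ * _); rewrite mulrAC.
have := E 1; under eq_fun do rewrite mul1r; move=> ->.
have := E (-1); under eq_fun do rewrite mulN1r; move=> ->.
rewrite rmorphN rmorph1 mulN1r mul1r normc_parallelogram.
by rewrite ComplexField.Normc.normcM normc_cis mul1r ab -exprS.
Qed.

Lemma rudin_shapiro k : exists a : nat -> R, (forall m, a m ^+ 2 = 1) /\
  forall y, normc (trig_sum (2 ^ k) (fun m => (a m)%:C) y) ^+ 2 <= 2 ^+ k.+1.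
Proof.
have [a [b [a1 _ ab]]] := rudin_shapiro_pair k; exists a; split => // y.
by rewrite -(ab y) lerDl sqr_ge0.
Qed.

(** By the double angle formula [cos y = 1] forces [sin (y / 2) = 0], while [y / 2] lies strictly
    between 0 and pi. *)
Lemma cis_neq1 (y : R) : 0 < y < 2 * pi -> cis y != 1.
Proof.
move=> /andP[y0 y2]; apply/eqP => -[c1 _].
have : 0 < sin (y / 2) by apply: sin_gt0_pi; lra.
have := cosD (y / 2) (y / 2); rewrite -splitr c1 => h.
have := cos2Dsin2 (y / 2) => h2 s0.
suff : sin (y / 2) ^+ 2 = 0 by move/eqP; rewrite sqrf_eq0 gt_eqF.
by lra.
Qed.

Lemma sum_cis_root (N k : nat) : (0 < k < N)%N ->
  \sum_(i < N) cis (k%:R * (2 * pi * (i%:R / N%:R))) = 0 :> C.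
Proof.
move=> /andP[k0 kN]; have N0 : (0 < N%:R :> R) by rewrite ltr0n (leq_trans _ kN).
set z := cis (2 * pi * (k%:R / N%:R)) : C.
have z1 : z - 1 != 0.
  rewrite subr_eq0; apply: cis_neq1; have p0 := pi_gt0 R.
  have : 0 < (k%:R / N%:R : R) < 1.
    apply/andP; split; first by rewrite divr_gt0// ltr0n.
    by rewrite ltr_pdivrMr// mul1r ltr_nat.
  by move=> /andP[? ?]; apply/andP; split; nra.
apply: (mulfI z1); rewrite mulr0.
transitivity (z ^+ N - 1); last first.
  rewrite -cisM_nat (_ : _ *+ N = pi *+ 2 *+ k); first by rewrite cis_2pi_nat subrr.
  by rewrite -mulr_natr -[RHS]mulr_natr -[pi *+ 2]mulr_natr; field; rewrite gt_eqF.
rewrite subrX1; congr (_ * _); apply: eq_bigr => i _.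
rewrite -cisM_nat; congr cis.
by rewrite -[RHS]mulr_natr; field; rewrite gt_eqF.
Qed.

(** Each product is a root of unity with exponent [l - m]; for [l < m] the sum is conjugated so that
    the exponent stays a natural number. *)
Lemma sum_cis_orthogonal (N l m : nat) : (l < N)%N -> (m < N)%N ->
  \sum_(i < N) cis (l%:R * (2 * pi * (i%:R / N%:R))) *
    conjc (cis (m%:R * (2 * pi * (i%:R / N%:R)))) = (N%:R *+ (l == m)) :> C.
Proof.
move=> lN mN.
have E (l' m' : nat) (y : R) : (m' <= l')%N ->
    cis (l'%:R * y) * conjc (cis (m'%:R * y)) = cis ((l' - m')%:R * y).
  by move=> h; rewrite conjc_cis -cisD natrB// mulrBl.
case: (ltngtP l m) => [lm|ml|<-].
- rewrite (eq_bigr (fun i : 'I_N => conjc (cis ((m - l)%:R * (2 * pi * (i%:R / N%:R)))))).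
    rewrite -conjc_sum sum_cis_root ?conjc0// subn_gt0 lm /=.
    exact: leq_ltn_trans (leq_subr _ _) mN.
  by move=> i _; rewrite -(E _ _ _ (ltnW lm)) conjc_mul conjcK mulrC.
- under eq_bigr do rewrite E ?(ltnW ml)//.
  rewrite sum_cis_root// subn_gt0 ml /=.
  exact: leq_ltn_trans (leq_subr _ _) lN.
- rewrite (eq_bigr (fun=> 1)); first by rewrite sumr_const card_ord.
  by move=> i _; rewrite mulc_conjc normc_cis expr1n.
Qed.

End rudin_shapiro.

(** * Summability over dyadic blocks *)

Section sparse_sum.
Context {R : realType} (T : choiceType).

(** Block [j] has at most [2 ^ j] terms of size [2]^ (- (e * j))[, so the block sums are dominated
    by a geometric series of ratio]2 [^ (1 - e) < 1]. *)
Lemma esum_dyadic (pt : nat -> nat -> T) (F : T -> R) (e : R) :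
  (forall j m j' m', pt j m = pt j' m' -> j = j' /\ m = m') ->
  (forall k, 0 <= F k) -> 1 < e ->
  (forall k, F k != 0 -> exists j m, [/\ k = pt j m, (m < 2 ^ j)%N & F k <= 2 `^ (- (e * j%:R))]) ->
  (\esum_(k in [set: T]) (F k)%:E < +oo)%E.
Proof.
move=> ptI F0 e1 FP.
pose S : set (nat * nat) := [set: nat] `*`` (fun j => `I_(2 ^ j)).
pose g (p : nat * nat) := pt p.1 p.2.
have gI : set_inj S g by move=> [j m] [j' m'] _ _ /ptI[/= -> ->].
rewrite (esumID (g @` S)); last by move=> k _; rewrite lee_fin.
rewrite [X in (_ + X)%E]esum1 ?adde0; last first.
  move=> k [_ /= nS]; congr _%:E; apply/eqP; apply: contrapT => /negP Fk.
  by apply: nS; have [j [m [kE mj _]]] := FP _ Fk; exists (j, m).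
rewrite setTI esum_image// -(@esum_esum R nat nat [set: nat] (fun j => `I_(2 ^ j))
  (fun j m => (F (pt j m))%:E)); last first.
  by move=> *; rewrite lee_fin.
pose rho : R := 2 `^ (1 - e).
have rho0 : 0 < rho by exact: powR_gt0.
have rho1 : rho < 1.
  rewrite -[ltRHS](powRr0 2) /rho /powR pnatr_eq0 /= ltr_expR mul0r.
  by rewrite nmulr_rlt0 ?ln_gt0 ?ltr1n// subr_lt0.
apply: (@le_lt_trans _ _ (\esum_(j in [set: nat]) (rho ^+ j)%:E)%E).
  apply: le_esum => j _.
  apply: (@le_trans _ _ (\esum_(m in `I_(2 ^ j)) (2 `^ (- (e * j%:R)))%:E)%E).
    apply: le_esum => m /= mj; rewrite lee_fin.
    have [->|] := eqVneq (F (pt j m)) 0; first exact: powR_ge0.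
    by move=> /FP[j' [m' [/ptI[<- _] _]]].
  rewrite esum_fset; [|exact: finite_II|by move=> *; rewrite lee_fin powR_ge0].
  rewrite -fsbig_ord sumEFin lee_fin sumr_const card_ord -[leLHS]mulr_natl.
  rewrite natrX -(@powR_mulrn _ 2)// -powRD ?pnatr_eq0 ?implybT//.
  by rewrite -powR_mulrn ?(ltW rho0)// /rho -powRrM; rewrite mulrBl mul1r.
rewrite -nneseries_esumT; last by move=> j; rewrite lee_fin exprn_ge0// ltW.
have rho1' : `|rho| < 1 by rewrite gtr0_norm.
have : (EFin \o series (geometric 1 rho)) @ \oo --> (1 * (1 - rho)^-1)%:E.
  apply: cvg_EFin; first by apply: nearW.
  exact: cvg_geometric_series.
rewrite (_ : EFin \o _ = fun k => (\sum_(0 <= i < k) (rho ^+ i)%:E)%E); last first.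
  by apply/funext => k; rewrite /= /series /= sumEFin; congr _%:E; apply: eq_bigr => i _; rewrite mul1r.
by move=> /cvg_lim -> //; rewrite ltry.
Qed.

End sparse_sum.

(** * Windows and windowed integrals *)

Section windows.
Context {R : realType} {n : nat}.
Local Notation C := R[i].

(** Later estimates use the windows only through these constants. All three can be weakened, so that
    the two windows of the theorem share them. *)
Definition is_window (M rho delta : R) (psi : 'rV[R]_n -> R) :=
  [/\ smooth psi, forall x, 0 <= psi x <= M,
      forall (x : 'rV[R]_n) i, rho < `|x ord0 i| -> psi x = 0 &
      forall x : 'rV[R]_n, (forall i, `|x ord0 i| <= delta) -> 2^-1 <= psi x].

Lemma is_window_weaken (M rho delta M' rho' delta' : R) psi :
  M <= M' -> rho <= rho' -> delta' <= delta ->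
  is_window M rho delta psi -> is_window M' rho' delta' psi.
Proof.
move=> MM rr dd [? psiM supp near0]; split => //.
- by move=> x; have /andP[-> h] := psiM x; rewrite (le_trans h).
- by move=> x i xi; apply: (supp x i); exact: le_lt_trans xi.
- by move=> x xd; apply: near0 => i; exact: le_trans dd.
Qed.

Lemma coord_le_norm (x : 'rV[R]_n) i : `|x ord0 i| <= `|x|.
Proof.
rewrite [leRHS]/Num.norm /= mx_normrE.
exact: (@le_bigmax _ _ _ (0 : R) (fun ij : 'I_1 * 'I_n => `|x ij.1 ij.2|) (ord0, i)).
Qed.

Lemma Cc_infty_window (phi : 'rV[R]_n -> C) :
  Cc_infty phi -> phi 0 = 1 -> (forall x, 0 <= phi x) ->
  phi = (fun x => (complex.Re (phi x))%:C) /\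
  exists M rho delta, [/\ 0 < M, 0 < rho, 0 < delta &
    is_window M rho delta (fun x => complex.Re (phi x))].
Proof.
move=> [[sRe _] cK] phi0 phi_ge0.
have reE : phi = (fun x => (complex.Re (phi x))%:C).
  (* In the order of the complex numbers, [0 <= phi x] includes the vanishing of the imaginary
     part. *)
  by apply/funext => x; have := phi_ge0 x; case: (phi x) => a b; rewrite lecE /= => /andP[/eqP -> _].
split => //.
set psi := fun x => complex.Re (phi x).
have psi0 x : 0 <= psi x.
  by have := phi_ge0 x; rewrite /psi; case: (phi x) => a b; rewrite lecE /= => /andP[_].
have cpsi : continuous psi by exact: (sRe [::]).1.
have supp x : psi x != 0 -> closure [set x | phi x != 0] x.
  move=> px; apply: subset_closure => /=; apply: contra px => /eqP px.
  by rewrite /psi px.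
have [rho rho0 Hrho] : exists2 rho : R, 0 < rho &
    forall x, psi x != 0 -> forall i, `|x ord0 i| <= rho.
  have [B [_ HB]] := compact_bounded cK.
  exists (`|B| + 1); first by rewrite ltr_wpDl.
  move=> x px i; apply: le_trans (coord_le_norm _ _) _.
  by apply: (HB (`|B| + 1)); [rewrite ltr_pwDr// ler_norm|exact: supp].
have [M M0 HM] : exists2 M : R, 0 < M & forall x, psi x <= M.
  have /compact_bounded[B [_ HB]] :
      compact (psi @` closure [set x | phi x != 0]).
    by apply: continuous_compact => //; exact: continuous_subspaceT.
  exists (`|B| + 1); first by rewrite ltr_wpDl.
  move=> x; have [->|px] := eqVneq (psi x) 0; first by rewrite addr_ge0.
  apply: le_trans (ler_norm _) _; apply: (HB (`|B| + 1)).
    by rewrite ltr_pwDr// ler_norm.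
  by exists x => //; exact: supp.
have [delta delta0 Hd] : exists2 delta : R, 0 < delta &
    forall x : 'rV[R]_n, (forall i, `|x ord0 i| <= delta) -> 2^-1 <= psi x.
  have : nbhs (0 : 'rV[R]_n) [set x | 2^-1 < psi x].
    apply: (cpsi 0 [set y | 2^-1 < y]); apply: open_nbhs_nbhs; split; first exact: open_gt.
    by rewrite /psi phi0 /= invf_lt1// ltr1n.
  move=> /nbhs_ballP[e /= e0 He]; exists (e / 2); first by rewrite divr_gt0.
  move=> x xe; apply/ltW/He; split => // i j; rewrite (ord1 i) /ball /= mxE sub0r normrN.
  by rewrite (le_lt_trans (xe j))// gtr_pMr// invf_lt1// ltr1n.
exists M, rho, delta; split => //; split => //.
- by move=> x; rewrite psi0 HM.
- move=> x i xi; apply/eqP; apply: contraT => /Hrho/(_ i).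
  by rewrite leNgt xi.
Qed.

End windows.

Section small_angles.
Context {R : realType}.

Lemma normr_sin_le (y : R) : `|sin y| <= `|y|.
Proof.
wlog y0 : y / 0 < y => [H|].
  case: (ltgtP y 0) => [yN|y0|->]; last by rewrite sin0.
    by rewrite -(normrN y) -(normrN (sin y)) -sinN; apply: H; rewrite oppr_gt0.
  exact: H.
have [|c _] := @MVT R sin cos 0 y y0 (fun x _ => is_derive_sin x).
  by apply: continuous_subspaceT; exact: continuous_sin.
rewrite sin0 !subr0 => ->; rewrite normrM ler_piMl//.
exact: cos_max.
Qed.

(** Here sin^2 is at most 1/16, so cos^2 is at least 15/16, and the cosine is positive because [y]
    lies within pi/2. *)
Lemma cos_ge_half (y : R) : `|y| <= 4^-1 -> 2^-1 <= cos y.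
Proof.
move=> y4; have p2 := pi_ge2 R.
have c0 : 0 < cos y.
  by apply: cos_gt0_pihalf; move: y4; rewrite ler_norml => /andP[? ?]; apply/andP; split; lra.
have := cos2Dsin2 y; have : sin y ^+ 2 <= 4^-1 ^+ 2.
  by rewrite -real_normK ?num_real// lerXn2r ?nnegrE// (le_trans (normr_sin_le y)).
by nra.
Qed.

End small_angles.

Section windowed_integrals.
Context {R : realType} {n : nat}.
Local Notation C := R[i].
Local Notation mu := (@lebesgue_rV R n).
Local Notation normc := ComplexField.Normc.normc.
Variables (M rho delta : R) (psi chi : 'rV[R]_n -> R).
Hypotheses (M0 : 0 < M) (rho0 : 0 < rho) (delta0 : 0 < delta)
  (bpsi : is_window M rho delta psi) (bchi : is_window M rho delta chi).
Variables (s b : 'I_n -> R).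
Hypothesis s0 : forall i, 0 < s i.

Definition envelope (t : 'rV[R]_n) : R := psi (rescale s b t).

Definition envelope_box : set 'rV[R]_n := centered_box b (fun i => rho / s i).

Lemma envelope_ge0 t : 0 <= envelope t.
Proof. by case: bpsi => _ /(_ (rescale s b t))/andP[]. Qed.

Lemma envelope_support t : envelope t != 0 -> envelope_box t.
Proof.
case: bpsi => _ _ supp _ et i; rewrite leNgt; apply/negP => h.
case/eqP: et; apply: (supp _ i); rewrite mxE normrM gtr0_norm//.
by rewrite -ltr_pdivrMl// mulrC.
Qed.

Lemma envelope_le t : envelope t <= M * \1_envelope_box t.
Proof.
have [->|et] := eqVneq (envelope t) 0.
  by rewrite mulr_ge0 ?(ltW M0)// indicE.
rewrite indicE mem_set ?mulr1; last exact: envelope_support.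
by case: bpsi => _ /(_ (rescale s b t))/andP[].
Qed.

Lemma measurable_envelope : measurable_fun setT envelope.
Proof.
apply: continuous_rV_measurable => x.
apply: continuous_comp; first exact: continuous_rescale.
by case: bpsi => /(_ [::])[+ _] _ _ _; exact.
Qed.

Lemma chi_ge0 x : 0 <= chi x.
Proof. by case: bchi => _ /(_ x)/andP[]. Qed.

Lemma chi_le x : chi x <= M.
Proof. by case: bchi => _ /(_ x)/andP[]. Qed.

Lemma measurable_chi : measurable_fun setT chi.
Proof. by apply: continuous_rV_measurable; case: bchi => /(_ [::])[]. Qed.

Lemma measurable_translate (x : 'rV[R]_n) : measurable_fun setT (fun t : 'rV[R]_n => t - x).
Proof.
apply: measurable_fun_rV => i; rewrite /rV_coord /comp.
under eq_fun do rewrite !mxE.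
by apply: measurable_funB => //; exact: measurable_rV_coord.
Qed.

Lemma measurable_window x :
  measurable_fun setT (fun t => envelope t * chi (t - x)).
Proof.
apply: measurable_funM; first exact: measurable_envelope.
exact: measurableT_comp measurable_chi (measurable_translate x).
Qed.

Lemma envelope_boxE : mu envelope_box = (\prod_(i < n) (2 * (rho / s i)))%:E.
Proof. by rewrite lebesgue_centered_box// => i; rewrite ltW// divr_gt0. Qed.

Lemma window_le x t : envelope t * chi (t - x) <= M * M * \1_envelope_box t.
Proof.
rewrite -mulrA mulrCA mulrC ler_pM ?envelope_ge0 ?chi_ge0 ?chi_le//.
exact: envelope_le.
Qed.

Definition mass (x : 'rV[R]_n) : R := \int[mu]_t (envelope t * chi (t - x)).

(** The short-time transform of the envelope up to a unimodular factor. Measuring the phase from the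
    center [b] makes it small on the support of the envelope. *)
Definition windowed_ft (x w : 'rV[R]_n) : C :=
  cintegral (fun t => (envelope t * chi (t - x))%:C *
    cis (- (2 * pi * dot w (t - \row_i b i)))).

Lemma measurable_phase (w c : 'rV[R]_n) :
  measurable_fun setT (fun t : 'rV[R]_n => - (2 * pi * dot w (t - c))).
Proof.
apply: measurableT_comp => //; apply: measurable_funM => //.
apply: measurable_dot => i //.
exact: (measurableT_comp (measurable_rV_coord i) (measurable_translate c)).
Qed.

Lemma cintegrable_windowed x w : cintegrable (fun t => (envelope t * chi (t - x))%:C *
    cis (- (2 * pi * dot w (t - \row_i b i)))).
Proof.
apply: (@bounded_cintegrable _ _ _ (M * M) envelope_box).
- apply: measurable_complexM; first by apply: measurable_complex_real; exact: measurable_window.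
  by apply: measurable_complex_cis; exact: measurable_phase.
- exact: measurable_centered_box.
- by rewrite envelope_boxE ltry.
- move=> t; rewrite ComplexField.Normc.normcM normc_cis mulr1 normc_real.
  by rewrite ger0_norm ?window_le// mulr_ge0 ?envelope_ge0 ?chi_ge0.
Qed.

Lemma integrable_window x :
  mu.-integrable setT (EFin \o (fun t => envelope t * chi (t - x))).
Proof.
apply: (@bounded_integrable _ _ _ (M * M) envelope_box).
- exact: measurable_window.
- exact: measurable_centered_box.
- by rewrite envelope_boxE ltry.
- by move=> t; rewrite ger0_norm ?window_le// mulr_ge0 ?envelope_ge0 ?chi_ge0.
Qed.

Lemma mass_ge0 x : 0 <= mass x.
Proof. by apply: Rintegral_ge0 => t _; rewrite mulr_ge0 ?envelope_ge0 ?chi_ge0. Qed.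

(** On the box of radii [delta / s i] both factors are at least 1/2. For [chi] this uses [s i >= 2]:
    [t] and [x] are each within [delta / 2] of the center, hence within [delta] of each other. *)
Lemma mass_lower (x : 'rV[R]_n) : (forall i, 2 <= s i) ->
  (forall i, `|x ord0 i - b i| <= delta / 2) ->
  4^-1 * \prod_(i < n) (2 * (delta / s i)) <= mass x.
Proof.
move=> s2 xb; set D := centered_box b (fun i => delta / s i).
have mD : measurable D by exact: measurable_centered_box.
have muD : mu D = (\prod_(i < n) (2 * (delta / s i)))%:E.
  by rewrite lebesgue_centered_box// => i; rewrite ltW// divr_gt0.
have iD : mu.-integrable setT (EFin \o (fun t => 4^-1 * \1_D t : R)).
  apply: (@bounded_integrable _ _ _ 4^-1 D) => //.
  - by apply: measurable_funM => //; exact: measurable_indic.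
  - by rewrite muD ltry.
  - by move=> t; rewrite ger0_norm// mulr_ge0// indicE.
have -> : 4^-1 * \prod_(i < n) (2 * (delta / s i)) = \int[mu]_t (4^-1 * \1_D t).
  rewrite RintegralZl//; last first.
    apply: (@bounded_integrable _ _ _ 1 D) => //.
    - by rewrite muD ltry.
    - by move=> t; rewrite mul1r ger0_norm// indicE.
  congr (_ * _); rewrite /Rintegral (_ : integral _ _ _ = mu D) ?muD//.
  by rewrite integral_indic// setIT.
apply: le_Rintegral => //; first exact: integrable_window.
move=> t _; rewrite indicE; have [Dt|_] := boolP (t \in D); last first.
  by rewrite mulr0 mulr_ge0 ?envelope_ge0 ?chi_ge0.
rewrite inE in Dt; rewrite mulr1.
have -> : 4^-1 = 2^-1 * 2^-1 :> R by field.
have tb i : `|t ord0 i - b i| <= delta / s i by exact: Dt.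
apply: ler_pM => //.
- case: bpsi => _ _ _; apply => i; rewrite mxE normrM gtr0_norm//.
  by rewrite -ler_pdivlMl// mulrC.
- case: bchi => _ _ _; apply => i; rewrite !mxE.
  have -> : t ord0 i - x ord0 i = (t ord0 i - b i) - (x ord0 i - b i) by ring.
  rewrite (le_trans (ler_normB _ _))// (splitr delta) lerD//.
  rewrite (le_trans (tb i))// ler_pM2l// lef_pV2 ?posrE//.
Qed.

(** Each coordinate contributes at most [(s i / L) * (rho / s i) = rho / L] to the dot product, so
    the phase is at most [2 * pi * n * rho / L]; the factor 8 in the condition turns this into
    1/4. *)
Lemma phase_small (L : R) (w t : 'rV[R]_n) : 0 < L -> 8 * pi * rho * n%:R <= L ->
  (forall i, `|w ord0 i| * L <= s i) -> envelope_box t ->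
  `|2 * pi * dot w (t - \row_i b i)| <= 4^-1.
Proof.
move=> L0 Lrho wL tb.
have p0 := pi_gt0 R.
have H : `|dot w (t - \row_i b i)| <= rho / L * n%:R.
  rewrite /dot (le_trans (ler_norm_sum _ _ _))//.
  have -> : rho / L * n%:R = \sum_(i < n) (rho / L) by rewrite sumr_const card_ord mulr_natr.
  apply: ler_sum => i _; rewrite normrM !mxE.
  apply: (@le_trans _ _ (s i / L * (rho / s i))); last first.
    by rewrite le_eqVlt; apply/orP; left; apply/eqP; field; rewrite !gt_eqF.
  by apply: ler_pM => //; rewrite ler_pdivlMr.
rewrite normrM gtr0_norm ?mulr_gt0//.
apply: (le_trans (ler_wpM2l _ H)); first by rewrite mulr_ge0// ltW.
rewrite (_ : 2 * pi * _ = (8 * pi * rho * n%:R) / L / 4); last by field; rewrite gt_eqF.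
by rewrite -[leRHS]mul1r ler_wpM2r// ler_pdivrMr// mul1r.
Qed.

(** The integrand is a nonnegative weight times a phase factor of angle at most 1/4, so there is no
    cancellation in the real part. *)
Lemma windowed_ft_lower (L : R) (x w : 'rV[R]_n) : 0 < L -> 8 * pi * rho * n%:R <= L ->
  (forall i, `|w ord0 i| * L <= s i) ->
  mass x / 2 <= complex.Re (windowed_ft x w) /\
  `|complex.Im (windowed_ft x w)| <= mass x / 4.
Proof.
move=> L0 Lrho wL; have [i1 i2] := cintegrable_windowed x w.
have iw := integrable_window x.
have ph t : envelope t != 0 -> `|- (2 * pi * dot w (t - \row_i b i))| <= 4^-1.
  by rewrite normrN => /envelope_support; exact: (phase_small L0).
have iZ (a : R) : mu.-integrable setT (EFin \o (fun t => a * (envelope t * chi (t - x)))).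
  exact: (integrableZl measurableT a iw).
have wge0 t : 0 <= envelope t * chi (t - x) by rewrite mulr_ge0 ?envelope_ge0 ?chi_ge0.
split.
- rewrite mulrC /mass -RintegralZl//; apply: le_Rintegral => // t _.
  rewrite Re_mulc /= mul0r subr0 mulrC.
  have [->|et] := eqVneq (envelope t) 0; first by rewrite !mul0r.
  by rewrite ler_wpM2l//; apply: cos_ge_half; exact: ph.
- apply: le_trans (le_normr_Rintegral measurableT i2) _.
  rewrite [leRHS]mulrC /mass -RintegralZl//; apply: le_Rintegral => //.
    exact: (integrable_norm i2).
  move=> t _; rewrite Im_mulc /= mul0r addr0 normrM (ger0_norm (wge0 t)) [leRHS]mulrC.
  have [->|et] := eqVneq (envelope t) 0; first by rewrite !mul0r.
  rewrite ler_wpM2l//.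
  by apply: le_trans (normr_sin_le _) _; exact: ph.
Qed.

End windowed_integrals.

(** * Modulated bumps *)

Section dot_facts.
Context {R : realType} {n : nat}.
Implicit Types x y z : 'rV[R]_n.

Lemma dotBl x y z : dot (x - y) z = dot x z - dot y z.
Proof. by rewrite /dot -sumrB; apply: eq_bigr => i _; rewrite !mxE mulrBl. Qed.

Lemma dotBr x y z : dot x (y - z) = dot x y - dot x z.
Proof. by rewrite /dot -sumrB; apply: eq_bigr => i _; rewrite !mxE mulrBr. Qed.

Lemma dot_delta (a : R) i x : dot (a *: delta_mx ord0 i) x = a * x ord0 i.
Proof.
rewrite /dot (bigD1 i)//= big1 ?addr0 => [|k ki]; rewrite !mxE eqxx /=.
  by rewrite eqxx mulr1.
by rewrite (negbTE ki) mulr0 mul0r.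
Qed.

End dot_facts.

Section stft_bounds.
Context {R : realType} {n : nat}.
Local Notation C := R[i].
Local Notation mu := (@lebesgue_rV R n).
Local Notation normc := ComplexField.Normc.normc.

(** The real and imaginary parts are bounded separately, whence the factor 2. The bound serves only
    to prove integrability, where its size is immaterial. *)
Lemma normc_cintegral_le (f : 'rV[R]_n -> C) (M V : R) (D : set 'rV[R]_n) :
  cmeasurable f -> measurable D -> mu D = V%:E ->
  (forall x, normc (f x) <= M * \1_D x) -> normc (cintegral f) <= 2 * (M * V).
Proof.
move=> mf mD DV fM.
have Doo : (mu D < +oo)%E by rewrite DV ltry.
have [i1 i2] := bounded_cintegrable mf mD Doo fM.
have iD : mu.-integrable setT (EFin \o (fun x => M * \1_D x)).
  apply: (@bounded_integrable _ _ _ `|M| D) => //.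
  - by apply: measurable_funM => //; exact: measurable_indic.
  - by move=> x; rewrite normrM ler_wpM2l// ger0_norm// indicE.
have ED : \int[mu]_x (M * \1_D x) = M * V.
  rewrite RintegralZl//; last first.
    apply: (@bounded_integrable _ _ _ 1 D) => //.
    by move=> x; rewrite mul1r ger0_norm// indicE.
  congr (_ * _); rewrite /Rintegral (_ : integral _ _ _ = mu D) ?DV//.
  by rewrite integral_indic// setIT.
have normc_le (z : C) : normc z <= `|complex.Re z| + `|complex.Im z|.
  rewrite -[leRHS]ger0_norm ?addr_ge0// -ler_sqr ?nnegrE ?normc_ge0// sqr_normcE.
  rewrite ger0_norm ?addr_ge0// sqrrD !real_normK ?num_real//.
  by rewrite lerD2r lerDl mulrn_wge0// mulr_ge0.
rewrite (le_trans (normc_le _))// mulrDl mul1r lerD//.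
  apply: le_trans (le_normr_Rintegral measurableT i1) _; rewrite -ED.
  apply: le_Rintegral => //; first exact: (integrable_norm i1).
  by move=> x _; exact: le_trans (normr_Re_le _) (fM x).
apply: le_trans (le_normr_Rintegral measurableT i2) _; rewrite -ED.
apply: le_Rintegral => //; first exact: (integrable_norm i2).
by move=> x _; exact: le_trans (normr_Im_le _) (fM x).
Qed.

Lemma stft_bounded (phi f : 'rV[R]_n -> C) (A M V : R) (B : set 'rV[R]_n) :
  cmeasurable phi -> cmeasurable f -> measurable B -> mu B = V%:E ->
  (forall x, normc (phi x) <= M) -> (forall x, normc (f x) <= A * \1_B x) ->
  forall x w, normc (stft phi f x w) <= 2 * (A * M * V).
Proof.
move=> mphi mf mB BV phiM fA x w; apply: (normc_cintegral_le (D := B)) => //.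
  apply: measurable_complexM; first apply: measurable_complexM => //.
    apply: measurable_complex_conjc.
    by split; [exact: measurableT_comp mphi.1 (measurable_translate x)|
               exact: measurableT_comp mphi.2 (measurable_translate x)].
  apply: measurable_complex_cis; apply: measurableT_comp => //.
  apply: measurable_funM => //; apply: measurable_dot => i //.
  exact: measurable_rV_coord.
move=> t; rewrite !ComplexField.Normc.normcM normc_cis mulr1 normc_conjc mulrAC.
by apply: ler_pM => //; exact: normc_ge0.
Qed.

End stft_bounds.

Section waves.
Context {R : realType} {n : nat}.
Local Notation C := R[i].
Local Notation mu := (@lebesgue_rV R n.+1).
Local Notation normc := ComplexField.Normc.normc.
Local Notation e0 := (delta_mx ord0 ord0 : 'rV[R]_n.+1).

(** The common form of both test functions: a spike has a compressed envelope and a one-term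
    polynomial, a flat function a fixed envelope and many terms. *)
Definition wave (psi : 'rV[R]_n.+1 -> R) (s b : 'I_n.+1 -> R) (N : nat) (c : nat -> C)
    (t : 'rV[R]_n.+1) : C :=
  (envelope psi s b t)%:C * trig_sum N c (2 * pi * (t ord0 ord0 - b ord0)).

Variables (M rho delta : R) (psi chi : 'rV[R]_n.+1 -> R).
Hypotheses (M0 : 0 < M) (rho0 : 0 < rho) (delta0 : 0 < delta)
  (bpsi : is_window M rho delta psi) (bchi : is_window M rho delta chi).
Variables (s b : 'I_n.+1 -> R).
Hypothesis s0 : forall i, 0 < s i.
Variables (N : nat) (c : nat -> C).

Lemma smooth_trig_sum (g : C -> R) :
  g = @complex.Re R \/ g = @complex.Im R ->
  smooth (fun t : 'rV[R]_n.+1 => g (trig_sum N c (2 * pi * (t ord0 ord0 - b ord0)))).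
Proof.
pose ph (m : nat) (t : 'rV[R]_n.+1) : R := m%:R * (2 * pi * (t ord0 ord0 - b ord0)).
have sc' m : smooth (fun t => cos (ph m t)).
  have := smooth_cos (ord0 : 'I_n.+1) (m%:R * (2 * pi)) (- (m%:R * (2 * pi) * b ord0)).
  by congr smooth; apply/funext => t; rewrite /ph; congr cos; ring.
have ss' m : smooth (fun t => sin (ph m t)).
  have := smooth_cos (ord0 : 'I_n.+1) (m%:R * (2 * pi))
    (- (m%:R * (2 * pi) * b ord0) - pi / 2).
  congr smooth; apply/funext => t; rewrite /ph addrA cosBpihalf.
  by congr sin; ring.
have smoothZ (a : R) (h : 'rV[R]_n.+1 -> R) : smooth h -> smooth (fun t => a * h t).
  exact: smoothM (smooth_cst a).
move=> [->|->]; rewrite /trig_sum.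
  under eq_fun do rewrite Re_sum.
  apply: smooth_sum => m; under eq_fun do rewrite Re_mulc -mulNr /=.
  exact: smoothD (smoothZ _ _ (sc' m)) (smoothZ _ _ (ss' m)).
under eq_fun do rewrite Im_sum.
apply: smooth_sum => m; under eq_fun do rewrite Im_mulc /=.
exact: smoothD (smoothZ _ _ (ss' m)) (smoothZ _ _ (sc' m)).
Qed.

Lemma smooth_envelope : smooth (envelope psi s b).
Proof. by case: bpsi => sp _ _ _; exact: smooth_rescale. Qed.

Lemma csmooth_wave : csmooth (wave psi s b N c).
Proof.
split; rewrite /wave.
  under eq_fun do rewrite Re_mulc /= mul0r subr0.
  by apply: smoothM; [exact: smooth_envelope|apply: smooth_trig_sum; left].
under eq_fun do rewrite Im_mulc /= mul0r addr0.
by apply: smoothM; [exact: smooth_envelope|apply: smooth_trig_sum; right].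
Qed.

Lemma cmeasurable_wave : cmeasurable (wave psi s b N c).
Proof.
have [s1 s2] := csmooth_wave.
by split; apply: continuous_rV_measurable; [exact: (s1 [::]).1|exact: (s2 [::]).1].
Qed.

Lemma wave_support t : wave psi s b N c t != 0 -> envelope_box rho s b t.
Proof.
move=> h; apply: (envelope_support bpsi s0); apply: contra h => /eqP h.
by rewrite /wave h mul0r.
Qed.

Lemma cschwartz_wave : cschwartz (wave psi s b N c).
Proof.
have [s1 s2] := csmooth_wave.
pose r := \sum_(i < n.+1) (`|b i| + rho / s i).
have rP (x : 'rV[R]_n.+1) i : r < `|x ord0 i| -> wave psi s b N c x = 0.
  move=> xi; apply/eqP; apply: contraT => /wave_support/(_ i) h.
  suff : `|x ord0 i| <= r by rewrite leNgt xi.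
  rewrite -(subrK (b i) (x ord0 i)) addrC (le_trans (ler_normD _ _))//.
  rewrite /r (bigD1 i)//= -[leLHS]addr0 lerD//; first by rewrite lerD2l.
  by apply: sumr_ge0 => k _; rewrite addr_ge0// ltW// divr_gt0.
by split; apply: (schwartz_compact (r := r)) => // x i /rP ->.
Qed.

Lemma normc_wave_le (K : R) : (forall y, normc (trig_sum N c y) <= K) ->
  forall t, normc (wave psi s b N c t) <= M * K * \1_(envelope_box rho s b) t.
Proof.
move=> cK t; rewrite ComplexField.Normc.normcM normc_real ger0_norm.
  rewrite [leRHS]mulrAC ler_pM ?normc_ge0 ?(envelope_ge0 bpsi)//.
  exact: (envelope_le M0 bpsi b s0).
exact: (envelope_ge0 bpsi).
Qed.

(** Modulation by [m] in the first coordinate shifts the frequency by [m] along that axis. The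
    unimodular prefactor depends only on [w] and the center, so it cancels when one transform is
    multiplied by the conjugate of another with the same center. *)
Lemma stft_wave (x w : 'rV[R]_n.+1) : stft (fun t => (chi t)%:C) (wave psi s b N c) x w =
  cis (- (2 * pi * dot w (\row_i b i))) *
  \sum_(m < N) c m * windowed_ft psi chi s b x (w - m%:R *: e0).
Proof.
have iG v := cintegrable_windowed M0 rho0 bpsi bchi b s0 x v.
rewrite mulr_sumr (eq_bigr (fun m : 'I_N => cintegral (fun t =>
    (cis (- (2 * pi * dot w (\row_i b i))) * c m) *
    ((envelope psi s b t * chi (t - x))%:C *
     cis (- (2 * pi * dot (w - m%:R *: e0) (t - \row_i b i))))))); last first.
  by move=> m _; rewrite cintegralZ// mulrA.
rewrite -cintegral_sum; last by move=> m; exact: cintegrableZ.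
rewrite /stft; congr cintegral; apply/funext => t.
rewrite /wave /trig_sum mulr_sumr !mulr_suml; apply: eq_bigr => m _.
rewrite conjc_real rmorphM /=.
have E : cis (m%:R * (2 * pi * (t ord0 ord0 - b ord0))) * cis (- (2 * pi * dot w t)) =
    cis (- (2 * pi * dot w (\row_i b i))) *
    cis (- (2 * pi * dot (w - m%:R *: e0) (t - \row_i b i))).
  by rewrite -!cisD dotBl !dotBr !dot_delta !mxE; congr cis; ring.
transitivity ((envelope psi s b t)%:C * (chi (t - x))%:C * c m *
    (cis (m%:R * (2 * pi * (t ord0 ord0 - b ord0))) * cis (- (2 * pi * dot w t)))).
  by ring.
by rewrite E; ring.
Qed.

(** The supports of the wave and of the translated window are disjoint in the coordinate [i]. *)
Lemma stft_wave_eq0 (x w : 'rV[R]_n.+1) i : rho + rho / s i < `|x ord0 i - b i| ->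
  stft (fun t => (chi t)%:C) (wave psi s b N c) x w = 0.
Proof.
move=> xi; rewrite /stft (_ : (fun t => _) = fun=> 0); first exact: cintegral0.
apply/funext => t; have [->|/wave_support/(_ i) ht] := eqVneq (wave psi s b N c t) 0.
  by rewrite !mul0r.
rewrite (_ : chi (t - x) = 0) ?conjc0 ?mulr0 ?mul0r//.
case: bchi => _ _ supp _; apply: (supp _ i); rewrite !mxE.
have := ler_normB (t ord0 i - b i) (t ord0 i - x ord0 i).
rewrite (_ : _ - _ - (_ - _) = x ord0 i - b i); last by ring.
by lra.
Qed.

End waves.

(** * One block *)

Local Arguments conjc : simpl never.

(** The constant is 1/4 - 1/16, with [a], [b] the real and [c], [e] the imaginary parts of the two
    transforms. *)
Lemma product_lower (R : realFieldType) (p q a b c e : R) : 0 <= p -> 0 <= q ->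
  p / 2 <= a -> q / 2 <= b -> `|c| <= p / 4 -> `|e| <= q / 4 ->
  3 / 16 * (p * q) <= a * b + c * e.
Proof.
move=> p0 q0 pa qb pc qe.
have h1 : p / 2 * (q / 2) <= a * b by apply: ler_pM => //; rewrite divr_ge0.
have : `|c * e| <= p / 4 * (q / 4) by rewrite normrM ler_pM.
by rewrite ler_norml => /andP[h2 _]; lra.
Qed.

(** [A + 2^-1] is the center of one block and [x] lies in the position cell at [B] of another, at
    least [k] further on; [t] stands for the radius of the envelope. *)
Lemma far_right (R : realFieldType) (rho k A B x t : R) : 0 < rho -> rho + 2 < k ->
  A + k <= B -> B <= x -> t <= 4^-1 -> rho + t < `|x - (A + 2^-1)|.
Proof. by move=> ? ? ? ? ?; rewrite ger0_norm; lra. Qed.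

Lemma far_left (R : realFieldType) (rho k A B x t : R) : 0 < rho -> rho + 2 < k ->
  B + k <= A -> x < B + 1 -> t <= 4^-1 -> rho + t < `|x - (A + 2^-1)|.
Proof. by move=> ? ? ? ? ?; rewrite ler0_norm; lra. Qed.

Section block.
Context {R : realType} {n : nat}.
Local Notation C := R[i].
Local Notation d := n.+1.
Local Notation mu := (@lebesgue_rV R d).
Local Notation mu2 := (@lebesgue_rV R (d + d)).
Local Notation normc := ComplexField.Normc.normc.
Local Notation e0 := (delta_mx ord0 ord0 : 'rV[R]_d).

Variables (M rho delta L : R) (spacing : nat).

(** The frequencies of a block lie along the first axis, so only that coordinate needs compression
    by [N]; the volume then drops by [N] and not by a power of it. *)
Definition block_scale (N : nat) (i : 'I_d) : R := if i == ord0 then L * N%:R else L.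

(** The added 1/2 puts the center in the middle of its unit cell, so that a support of radius at
    most 1/4 stays inside. *)
Definition block_center (j : nat) (i : 'I_d) : R :=
  (if i == ord0 then (spacing * j)%:R else 0) + 2^-1.

Definition axis_cell (k : nat) : 'rV[int]_d :=
  \row_i (if i == ord0 then k%:Z else 0).

Definition block_cell (j l : nat) : 'rV[int]_(d + d) :=
  row_mx (axis_cell (spacing * j)) (axis_cell l).

Lemma unit_cube_row (a b : 'rV[int]_d) (z : 'rV[R]_(d + d)) :
  unit_cube (row_mx a b) z <-> unit_cube a (lsubmx z) /\ unit_cube b (rsubmx z).
Proof.
split=> [h|[h1 h2] i].
  split=> i; first by have := h (lshift d i); rewrite row_mxEl mxE.
  by have := h (rshift d i); rewrite row_mxEr mxE.
case: (splitP i) => k ik.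
  have -> : i = lshift d k by exact: ord_inj.
  by have := h1 k; rewrite row_mxEl mxE.
have -> : i = rshift d k by exact: ord_inj.
by have := h2 k; rewrite row_mxEr mxE.
Qed.

Lemma block_cell_inj : (0 < spacing)%N -> forall j m j' m',
  block_cell j m = block_cell j' m' -> j = j' /\ m = m'.
Proof.
move=> sp j m j' m' /eq_row_mx[/rowP/(_ ord0) h1 /rowP/(_ ord0) h2].
move: h1 h2; rewrite !mxE /= => -[] /eqP; rewrite eqn_pmul2l// => /eqP -> [] ->.
by [].
Qed.

(* The part of the cell on which [core_lower] bounds both windowed transforms away
   from 0; on the rest of the cell their product still has nonnegative real part. *)
Definition block_core (j l : nat) : set 'rV[R]_(d + d) :=
  [set z | centered_box (block_center j) (fun=> delta / 2) (lsubmx z) /\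
           unit_cube (axis_cell l) (rsubmx z)].

(** As a product of intervals over all [d + d] coordinates the core is accessible to
    [lebesgue_rV_box]. *)
Lemma block_coreE j l : block_core j l = [set z | forall i, (match fintype.split i with
    | inl k => `[block_center j k - delta / 2, block_center j k + delta / 2]%classic
    | inr k => `[(axis_cell l ord0 k)%:~R, (axis_cell l ord0 k)%:~R + 1[%classic
    end) (z ord0 i)].
Proof.
rewrite /block_core centered_boxE unit_cube_box; apply/seteqP; split=> z /=.
  move=> [h1 h2] i; case: splitP => k ik.
    have -> : i = lshift d k by exact: ord_inj.
    by have := h1 k; rewrite mxE.
  have -> : i = rshift d k by exact: ord_inj.
  by have := h2 k; rewrite mxE.
move=> h; split=> k.
  have := h (lshift d k); rewrite mxE; case: splitP => k' /= kk.
    by rewrite (_ : k' = k)//; exact: ord_inj.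
  by have := ltn_ord k; rewrite kk ltnNge leq_addr.
have := h (rshift d k); rewrite mxE; case: splitP => k' /= kk.
  by have := ltn_ord k'; rewrite -kk ltnNge leq_addr.
by rewrite (_ : k' = k)//; apply: ord_inj; apply/eqP; rewrite -(eqn_add2l d) kk.
Qed.

Let coreA j l (i : 'I_(d + d)) : set (measurableTypeR R) := match fintype.split i with
    | inl k => `[block_center j k - delta / 2, block_center j k + delta / 2]%classic
    | inr k => `[(axis_cell l ord0 k)%:~R, (axis_cell l ord0 k)%:~R + 1[%classic
    end.

Let measurable_coreA j l i : measurable (coreA j l i).
Proof. by rewrite /coreA; case: fintype.split => k; exact: measurable_itv. Qed.

Lemma measurable_block_core j l : measurable (block_core j l).
Proof. by rewrite block_coreE; exact: (measurable_box (measurable_coreA j l)). Qed.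

Lemma lebesgue_block_core j l : 0 < delta -> mu2 (block_core j l) = (delta ^+ d)%:E.
Proof.
move=> d0; rewrite block_coreE (lebesgue_rV_box (measurable_coreA j l)).
rewrite big_split_ord /= [X in (_ * X)%E]big1 ?mule1; last first.
  move=> k _; rewrite /coreA; case: splitP => k' kk.
    by have := ltn_ord k'; rewrite -kk ltnNge leq_addr.
  rewrite lebesgue_measure_itv/= lte_fin ltrDl ltr01.
  by rewrite -EFinB addrAC subrr add0r.
rewrite (eq_bigr (fun=> delta%:E)); first by rewrite prodEFin prodr_const card_ord.
move=> k _; rewrite /coreA; case: splitP => k' /= kk; last first.
  by have := ltn_ord k; rewrite kk ltnNge leq_addr.
rewrite lebesgue_measure_itv/= lte_fin ifT; last by lra.
by rewrite -EFinB; congr _%:E; field.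
Qed.

Lemma block_core_sub j l : delta < 1 -> 0 < delta -> block_core j l `<=` unit_cube (block_cell j l).
Proof.
move=> d1 d0 z [h1 h2]; apply/unit_cube_row; split => // i.
have := h1 i; rewrite /= ler_distl /block_center !mxE.
case: (i == ord0) => /=;
  rewrite -?pmulrn ?mulr0z => /andP[? ?]; apply/andP; split; lra.
Qed.

Hypotheses (M0 : 0 < M) (rho0 : 0 < rho) (delta0 : 0 < delta) (delta1 : delta < 1).
Hypotheses (L2 : 2 <= L) (Lrho : 4 * rho <= L) (Lpi : 8 * pi * rho * d%:R <= L).
Hypothesis spacing_gt : rho + 2 < spacing%:R.

Let L0 : 0 < L. Proof. exact: lt_le_trans L2. Qed.

Lemma block_scale_ge N i : (0 < N)%N -> L <= block_scale N i.
Proof. by move=> N0; rewrite /block_scale; case: ifP => // _; rewrite ler_peMr ?(ltW L0)// ler1n. Qed.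

Lemma block_scale_gt0 N i : (0 < N)%N -> 0 < block_scale N i.
Proof. by move=> N0; apply: lt_le_trans L0 _; exact: block_scale_ge. Qed.

Lemma block_box_sub j N : (0 < N)%N ->
  envelope_box rho (block_scale N) (block_center j) `<=` unit_cube (axis_cell (spacing * j)).
Proof.
move=> N0 x xb i; have := xb i; rewrite /= ler_distl.
have : rho / block_scale N i <= 4^-1.
  rewrite ler_pdivrMr ?block_scale_gt0// -ler_pdivrMl// invrK.
  by apply: le_trans Lrho _; exact: block_scale_ge.
rewrite /block_center !mxE; move=> h; case: (i == ord0) => /=;
  rewrite -?pmulrn ?mulr0z => /andP[? ?]; apply/andP; split; lra.
Qed.

Lemma block_scale_prod (a : R) N : (0 < N)%N ->
  \prod_(i < d) (2 * (a / block_scale N i)) = (2 * a / L) ^+ d / N%:R.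
Proof.
move=> N0; have NR : (0 < N%:R :> R) by rewrite ltr0n.
rewrite big_ord_recl /= /block_scale /= (eq_bigr (fun=> 2 * a / L)); last first.
  by move=> i _; rewrite /=; ring.
by rewrite prodr_const card_ord [RHS]mulrC exprS; field; rewrite !gt_eqF.
Qed.

Variables (psi chiu chiv : 'rV[R]_d -> R).
Hypotheses (bpsi : is_window M rho delta psi) (bchiu : is_window M rho delta chiu)
  (bchiv : is_window M rho delta chiv).

Definition spike (j : nat) : 'rV[R]_d -> C :=
  wave psi (block_scale (2 ^ j)) (block_center j) 1 (fun=> 1).

Definition polyphase (j : nat) (c : nat -> C) : 'rV[R]_d -> C :=
  wave psi (block_scale 1) (block_center j) (2 ^ j) c.

Local Notation U j z := (stft (fun t => (chiu t)%:C) (spike j) (lsubmx z) (rsubmx z)).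
Local Notation V j c z :=
  (stft (fun t => (chiv t)%:C) (polyphase j c) (lsubmx z) (rsubmx z)).

(** The integrand of the weak form for block [j] of the symbol, without its weight. The same [c]
    enters the symbol and, conjugated, the polynomial. *)
Definition block_integrand (j : nat) (c : nat -> C) (z : 'rV[R]_(d + d)) : C :=
  \sum_(l < 2 ^ j) c l * (\1_(unit_cube (block_cell j l)) z)%:C * U j z * conjc (V j c z).

Local Notation Gu j z := (windowed_ft psi chiu (block_scale (2 ^ j)) (block_center j)
  (lsubmx z) (rsubmx z)).
Local Notation Gv j l z := (windowed_ft psi chiv (block_scale 1) (block_center j)
  (lsubmx z) (rsubmx z - l%:R *: e0)).

Let N0 j : (0 < 2 ^ j)%N. Proof. by rewrite expn_gt0. Qed.

Lemma stft_product j c z :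
  U j z * conjc (V j c z) = \sum_(m < 2 ^ j) conjc (c m) * (Gu j z * conjc (Gv j m z)).
Proof.
rewrite /spike /polyphase (stft_wave M0 rho0 bpsi bchiu) ?(stft_wave M0 rho0 bpsi bchiv).
- rewrite big_ord1 scale0r subr0 mul1r conjc_mul conjc_cis conjc_sum.
  rewrite mulrACA -cisD subrr cis0 mul1r mulr_sumr; apply: eq_bigr => m _.
  by rewrite conjc_mul; ring.
- by move=> i; exact: block_scale_gt0.
- by move=> i; exact: block_scale_gt0.
Qed.

Lemma spike_le j t : normc (spike j t) <=
  M * \1_(envelope_box rho (block_scale (2 ^ j)) (block_center j)) t.
Proof.
rewrite -[X in X * _]mulr1; apply: (normc_wave_le M0 bpsi).
  by move=> i; exact: block_scale_gt0.
by move=> y; rewrite /trig_sum big_ord1 mul1r normc_cis.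
Qed.

Definition twist (j : nat) (eps : nat -> R) (i : nat) (m : nat) : C :=
  (eps m)%:C * cis (m%:R * (2 * pi * (i%:R / (2 ^ j)%:R))).

Definition flat (j : nat) (eps : nat -> R) := (forall m, eps m ^+ 2 = 1) /\
  forall y, normc (trig_sum (2 ^ j) (fun m => (eps m)%:C) y) ^+ 2 <= 2 ^+ j.+1.

Lemma normc_twist j eps i m : flat j eps -> normc (twist j eps i m) = 1.
Proof.
move=> [e1 _]; rewrite ComplexField.Normc.normcM normc_cis mulr1 normc_real.
by apply/eqP; rewrite -sqrp_eq1// real_normK ?num_real// e1.
Qed.

(** The twist translates the argument of the polynomial, and the bound in [flat] is uniform in that
    argument. *)
Lemma trig_sum_twist j eps i y : flat j eps ->
  normc (trig_sum (2 ^ j) (twist j eps i) y) <= Num.sqrt (2 ^+ j.+1).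
Proof.
move=> [_ eP]; rewrite -ler_sqr ?nnegrE ?normc_ge0 ?sqrtr_ge0// sqr_sqrtr ?exprn_ge0//.
have -> : trig_sum (2 ^ j) (twist j eps i) y =
    trig_sum (2 ^ j) (fun m => (eps m)%:C) (2 * pi * (i%:R / (2 ^ j)%:R) + y).
  by apply: eq_bigr => m _; rewrite /twist -mulrA -cisD -mulrDr.
exact: eP.
Qed.

Lemma polyphase_le j eps i t : flat j eps -> normc (polyphase j (twist j eps i) t) <=
  M * Num.sqrt (2 ^+ j.+1) * \1_(envelope_box rho (block_scale 1) (block_center j)) t.
Proof.
move=> fe; apply: (normc_wave_le M0 bpsi).
  by move=> k; exact: block_scale_gt0.
by move=> y; exact: trig_sum_twist.
Qed.

Lemma cmeasurable_window chi : is_window M rho delta chi ->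
  cmeasurable (fun t : 'rV[R]_d => (chi t)%:C).
Proof.
case=> /(_ [::])[cc _] _ _ _; apply: measurable_complex_real.
exact: continuous_rV_measurable.
Qed.

Lemma cmeasurable_stft_wave chi s b N c : is_window M rho delta chi ->
  (forall i, 0 < s i) -> cmeasurable (fun z : 'rV[R]_(d + d) =>
    stft (fun t => (chi t)%:C) (wave psi s b N c) (lsubmx z) (rsubmx z)).
Proof.
move=> bchi s0; apply: cmeasurable_stft; first exact: cmeasurable_window.
exact: cmeasurable_wave bpsi _ _ _ _.
Qed.

Lemma stft_wave_bounded chi s b N c (A : R) : is_window M rho delta chi ->
  (forall i, 0 < s i) -> (forall t, normc (wave psi s b N c t) <= A * \1_(envelope_box rho s b) t) ->
  exists2 K, 0 <= K & forall x w, normc (stft (fun t => (chi t)%:C) (wave psi s b N c) x w) <= K.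
Proof.
move=> bchi s0 wA.
have H := stft_bounded (cmeasurable_window bchi) (cmeasurable_wave bpsi s b N c)
  (measurable_centered_box _ _) (envelope_boxE rho0 b s0) (M := M) _ wA.
exists `|2 * (A * M * \prod_(i < d) (2 * (rho / s i)))| => // x w.
apply: le_trans (ler_norm _); apply: H => t.
by rewrite normc_real ger0_norm ?(chi_ge0 bchi) ?(chi_le bchi).
Qed.

Lemma cintegrable_block j eps i : flat j eps ->
  cintegrable (block_integrand j (twist j eps i)).
Proof.
move=> fe; apply: cintegrable_sum => l.
have su k : 0 < block_scale (2 ^ j) k by exact: block_scale_gt0.
have sv k : 0 < block_scale 1 k by exact: block_scale_gt0.
have [Ku Ku0 HKu] := stft_wave_bounded bchiu su (spike_le j).
have [Kv Kv0 HKv] := stft_wave_bounded bchiv sv (fun t => polyphase_le i t fe).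
apply: (@bounded_cintegrable _ _ _ (Ku * Kv) (unit_cube (block_cell j l))).
- apply: measurable_complexM; first apply: measurable_complexM; first apply: measurable_complexM.
  + exact: measurable_complex_cst.
  + apply: measurable_complex_real; apply: measurable_indic; exact: measurable_unit_cube.
  + exact: cmeasurable_stft_wave.
  + by apply: measurable_complex_conjc; exact: cmeasurable_stft_wave.
- exact: measurable_unit_cube.
- by rewrite lebesgue_unit_cube ltry.
- move=> z; rewrite 3!ComplexField.Normc.normcM normc_conjc normc_twist// mul1r normc_real.
  rewrite ger0_norm ?indicE// -mulrA mulrC ler_wpM2r//.
  exact: (ler_pM (normc_ge0 _) (normc_ge0 _) (HKu _ _) (HKv _ _)).
Qed.

(* The sum over [i] is an orthogonality relation between [2 ^ j]-th roots of unity,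
   which leaves only the diagonal terms of the trilinear form. *)
Lemma sum_block_integrand j eps z : flat j eps ->
  \sum_(i < 2 ^ j) block_integrand j (twist j eps i) z =
  \sum_(l < 2 ^ j) ((2 ^ j)%:R * \1_(unit_cube (block_cell j l)) z)%:C *
    (Gu j z * conjc (Gv j l z)).
Proof.
move=> [e1 _]; rewrite /block_integrand exchange_big /=; apply: eq_bigr => l _.
under eq_bigr => i _ do rewrite -mulrA stft_product mulr_sumr.
rewrite exchange_big /= (bigD1 l)//= [X in _ + X]big1 ?addr0.
  rewrite (eq_bigr (fun i : 'I_(2 ^ j) => (\1_(unit_cube (block_cell j l)) z)%:C *
      (Gu j z * conjc (Gv j l z)) *
      (cis (l%:R * (2 * pi * (i%:R / (2 ^ j)%:R))) *
       conjc (cis (l%:R * (2 * pi * (i%:R / (2 ^ j)%:R))))))).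
    by rewrite -mulr_sumr sum_cis_orthogonal// eqxx mulr1n rmorphM /= rmorph_nat; ring.
  move=> i _; rewrite /twist conjc_mul conjc_real.
  (* The symbol and the conjugated polynomial carry the same real sign [eps l], whose square is
     1. *)
  have := e1 l; move=> /(congr1 (fun a : R => a%:C)); rewrite rmorphXn rmorph1 /= => e1l.
  by rewrite -[RHS]mul1r -e1l expr2; ring.
move=> m ml; rewrite (eq_bigr (fun i : 'I_(2 ^ j) => (\1_(unit_cube (block_cell j l)) z)%:C *
    (Gu j z * conjc (Gv j m z)) * ((eps l)%:C * (eps m)%:C) *
    (cis (l%:R * (2 * pi * (i%:R / (2 ^ j)%:R))) *
     conjc (cis (m%:R * (2 * pi * (i%:R / (2 ^ j)%:R))))))).
  rewrite -mulr_sumr sum_cis_orthogonal// (_ : (nat_of_ord l == m) = false) ?mulr0n ?mulr0//.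
  by apply/negbTE; rewrite eq_sym.
by move=> i _; rewrite /twist conjc_mul conjc_real; ring.
Qed.

(** The factor 3/16 comes from [product_lower], the square from [mass_lower] for both transforms,
    and [delta ^+ d] is the volume of a core. It does not depend on [j]: the factor [2 ^ j] from
    orthogonality cancels the small mass of the spike, and the number of cells makes up for the
    averaging. *)
Definition block_const : R :=
  3 / 16 * (4^-1 * (2 * delta / L) ^+ d) ^+ 2 * delta ^+ d.

Lemma block_const_gt0 : 0 < block_const.
Proof. by rewrite /block_const !mulr_gt0 ?exprn_gt0 ?mulr_gt0 ?exprn_gt0 ?mulr_gt0 ?invr_gt0. Qed.

Let c1 : R := 3 / 16 * (4^-1 * (2 * delta / L) ^+ d) ^+ 2.

(** On the frequency cell of [l] the first frequency is at most [2 ^ j], as the spike of scale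
    [L * 2 ^ j] allows, and after the shift by [l] it is at most 1, as the scale [L] allows. Both
    transforms thus have small phases; off the core the masses are still nonnegative. *)
Lemma core_lower j (l : nat) z : (l < 2 ^ j)%N ->
  c1 * \1_(block_core j l) z <=
  complex.Re (((2 ^ j)%:R * \1_(unit_cube (block_cell j l)) z)%:C *
    (Gu j z * conjc (Gv j l z))).
Proof.
move=> lN; have [zc|zc] := boolP (z \in unit_cube (block_cell j l)); last first.
  rewrite !indicE (negbTE zc) mulr0 mul0r (_ : _ \in _ = false) ?mulr0//.
  apply/negbTE; apply: contra zc; rewrite !inE; exact: block_core_sub.
have su k : 0 < block_scale (2 ^ j) k by exact: block_scale_gt0.
have sv k : 0 < block_scale 1 k by exact: block_scale_gt0.
have zl : unit_cube (axis_cell l) (rsubmx z) by move: zc; rewrite inE => /unit_cube_row[].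
have [uRe uIm] : mass psi chiu (block_scale (2 ^ j)) (block_center j) (lsubmx z) / 2 <=
    complex.Re (Gu j z) /\ `|complex.Im (Gu j z)| <=
    mass psi chiu (block_scale (2 ^ j)) (block_center j) (lsubmx z) / 4.
  apply: (@windowed_ft_lower _ _ M rho delta psi chiu M0 rho0 bpsi bchiu _ _ su L _ _ L0 Lpi) => i.
  have := zl i; rewrite /block_scale mxE; case: (i == ord0) => /= /andP[h1 h2].
    rewrite mulrC ler_wpM2l ?(ltW L0)// ger0_norm ?(le_trans _ h1)//.
    by apply/ltW/(lt_le_trans h2); rewrite -pmulrn natr1 ler_nat.
  by rewrite ler_piMl ?(ltW L0)// ger0_norm// ltW//; move: h2; rewrite add0r.
have [vRe vIm] : mass psi chiv (block_scale 1) (block_center j) (lsubmx z) / 2 <=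
    complex.Re (Gv j l z) /\ `|complex.Im (Gv j l z)| <=
    mass psi chiv (block_scale 1) (block_center j) (lsubmx z) / 4.
  apply: (@windowed_ft_lower _ _ M rho delta psi chiv M0 rho0 bpsi bchiv _ _ sv L _ _ L0 Lpi) => i.
  apply: (@le_trans _ _ L); last exact: block_scale_ge.
  rewrite ler_piMl ?(ltW L0)//.
  have := zl i; rewrite !mxE eqxx /=; case: (i == ord0) => /= /andP[h1 h2].
    by rewrite mulr1 ger0_norm; move: h1 h2; rewrite -?pmulrn; lra.
  by rewrite mulr0 subr0 ger0_norm// ltW//; move: h2; rewrite add0r.
set mU := mass _ _ _ _ _ in uRe uIm; set mV := mass _ _ _ _ _ in vRe vIm.
have mU0 : 0 <= mU by exact: (mass_ge0 bpsi bchiu).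
have mV0 : 0 <= mV by exact: (mass_ge0 bpsi bchiv).
rewrite Re_real_mul !indicE zc mulr1 Re_mulc Re_conjc Im_conjc mulrN opprK.
have key : 3 / 16 * (mU * mV) <= complex.Re (Gu j z) * complex.Re (Gv j l z) +
    complex.Im (Gu j z) * complex.Im (Gv j l z).
  exact: product_lower.
apply: (@le_trans _ _ ((2 ^ j)%:R * (3 / 16 * (mU * mV)))); last by rewrite ler_wpM2l.
have [zco|_] := boolP (z \in block_core j l); last first.
  by rewrite mulr0 !mulr_ge0.
move: zco; rewrite inE => -[zb _].
have hU : 4^-1 * ((2 * delta / L) ^+ d / (2 ^ j)%:R) <= mU.
  rewrite -block_scale_prod//; apply: (mass_lower M0 rho0 delta0 bpsi bchiu) => // i.
  by apply: le_trans L2 _; exact: block_scale_ge.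
have hV : 4^-1 * ((2 * delta / L) ^+ d / 1%:R) <= mV.
  rewrite -block_scale_prod//; apply: (mass_lower M0 rho0 delta0 bpsi bchiv) => // i.
  by apply: le_trans L2 _; exact: block_scale_ge.
have NR : 0 < (2 ^ j)%:R :> R by rewrite ltr0n.
have E0 : 0 <= (2 * delta / L) ^+ d by rewrite exprn_ge0// divr_ge0 ?mulr_ge0 ?(ltW L0) ?(ltW delta0).
apply: (@le_trans _ _ ((2 ^ j)%:R * (3 / 16 *
   ((4^-1 * ((2 * delta / L) ^+ d / (2 ^ j)%:R)) * (4^-1 * ((2 * delta / L) ^+ d / 1%:R)))))).
  by rewrite mulr1 /c1 le_eqVlt; apply/orP; left; apply/eqP; field; rewrite !gt_eqF.
rewrite ler_wpM2l ?(ltW NR)// ler_wpM2l//.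
by apply: ler_pM => //; rewrite mulr_ge0// divr_ge0// ltW.
Qed.

Lemma block_lower j eps : flat j eps ->
  exists i : nat, block_const <= complex.Re (cintegral (block_integrand j (twist j eps i))).
Proof.
move=> fe; have NR : 0 < (2 ^ j)%:R :> R by rewrite ltr0n.
suff H : (2 ^ j)%:R * block_const <=
    \sum_(i < 2 ^ j) complex.Re (cintegral (block_integrand j (twist j eps i))).
  (* If every twist fell short of [block_const], so would their average. *)
  apply: contrapT => /forallNP nH; move: H; apply/negP; rewrite -ltNge.
  rewrite mulr_natl -[X in _ *+ X]card_ord -sumr_const.
  apply: ltr_sum => [|i _]; last by rewrite ltNge; apply/negP; exact: nH.
  by apply/hasP; exists (Ordinal (N0 j)) => //; rewrite mem_index_enum.
have iB (i : 'I_(2 ^ j)) := cintegrable_block i fe.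
rewrite -Re_sum -cintegral_sum//.
have iS := cintegrable_sum (index_enum 'I_(2 ^ j)) iB.
pose D (l : 'I_(2 ^ j)) z : C := (c1 * \1_(block_core j l) z)%:C.
have c10 : 0 <= c1 by rewrite /c1 mulr_ge0// sqr_ge0.
have iD l : cintegrable (D l).
  apply: (@bounded_cintegrable _ _ _ c1 (block_core j l)).
  - apply: measurable_complex_real; apply: measurable_funM => //.
    by apply: measurable_indic; exact: measurable_block_core.
  - exact: measurable_block_core.
  - by rewrite lebesgue_block_core// ltry.
  - by move=> z; rewrite normc_real ger0_norm// mulr_ge0// indicE.
have -> : (2 ^ j)%:R * block_const = complex.Re (cintegral (fun z => \sum_(l < 2 ^ j) D l z)).
  rewrite cintegral_sum// Re_sum (eq_bigr (fun=> block_const)).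
    by rewrite sumr_const card_ord mulr_natl.
  move=> l _; rewrite (_ : complex.Re _ = \int[mu2]_z (c1 * \1_(block_core j l) z))//.
  rewrite /Rintegral; under eq_integral do rewrite EFinM.
  rewrite ge0_integralZl//; last first.
    by apply/measurable_EFinP; apply: measurable_indic; exact: measurable_block_core.
  rewrite integral_indic ?setIT//; last exact: measurable_block_core.
  transitivity (fine (c1%:E * (delta ^+ d)%:E)%E) => //.
  by congr (fine (_ * _)%E); exact: lebesgue_block_core.
apply: le_Rintegral => //.
- by have [] := cintegrable_sum (index_enum 'I_(2 ^ j)) iD.
- by have [] := iS.
move=> z _; rewrite sum_block_integrand// !Re_sum; apply: ler_sum => l _.
exact: core_lower.
Qed.

Lemma stft_wave_far j j' chi N N' c z : is_window M rho delta chi -> (0 < N)%N -> j != j' ->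
  unit_cube (axis_cell (spacing * j')) (lsubmx z) ->
  stft (fun t => (chi t)%:C) (wave psi (block_scale N) (block_center j) N' c)
    (lsubmx z) (rsubmx z) = 0.
Proof.
move=> bchi N_gt0 jj' zj'.
have s0 i : 0 < block_scale N i by exact: block_scale_gt0.
apply: (@stft_wave_eq0 _ _ M rho delta psi chi bpsi bchi _ _ s0 _ _ _ _ ord0).
have := zj' ord0; rewrite /axis_cell mxE /= -pmulrn => /andP[h1 h2].
have : rho / block_scale N ord0 <= 4^-1.
  rewrite ler_pdivrMr// -ler_pdivrMl// invrK.
  by apply: le_trans Lrho _; exact: block_scale_ge.
have sep (p q : nat) : (p < q)%N -> (spacing * p)%:R + spacing%:R <= (spacing * q)%:R :> R.
  by move=> pq; rewrite -natrD ler_nat addnC -mulnS leq_mul.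
rewrite /block_center /=; move: jj'; rewrite neq_ltn => /orP[/sep h|/sep h].
  exact: far_right rho0 spacing_gt h h1.
exact: far_left rho0 spacing_gt h h2.
Qed.

End block.

(** * All blocks *)

Section symbols.
Context {R : realType} {n : nat}.
Local Notation C := R[i].
Local Notation d := n.+1.
Local Notation normc := ComplexField.Normc.normc.
Variables (spacing : nat) (lambda : nat -> R) (gamma : nat -> nat -> C).
Hypothesis spacing0 : (0 < spacing)%N.

Local Notation cell := (@block_cell n spacing).

(** The only candidates for [j] and [l] are read off two coordinates of [k]; comparing [k] with
    [cell j l] then decides whether [k] belongs to a block. *)
Definition block_symbol (k : 'rV[int]_(d + d)) : C :=
  let j := (`|k ord0 (lshift d ord0)| %/ spacing)%N in
  let l := `|k ord0 (rshift d ord0)|%N in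
  if (k == cell j l) && (l < 2 ^ j)%N then (lambda j)%:C * gamma j l else 0.

Lemma block_symbol_cell j l : (l < 2 ^ j)%N ->
  block_symbol (cell j l) = (lambda j)%:C * gamma j l.
Proof.
move=> lj; rewrite /block_symbol /cell row_mxEl row_mxEr !mxE /= mulKn//.
by rewrite eqxx lj.
Qed.

Lemma block_symbol_neq0 k : block_symbol k != 0 ->
  exists j l, [/\ k = cell j l, (l < 2 ^ j)%N & block_symbol k = (lambda j)%:C * gamma j l].
Proof.
rewrite /block_symbol; set j := (_ %/ _)%N; set l := `|_|%N.
case: ifP => [/andP[/eqP kE lj] _|_]; last by rewrite eqxx.
by exists j, l.
Qed.

Lemma normc_block_symbol_neq0 k : normc (block_symbol k) != 0 -> block_symbol k != 0.
Proof. by apply: contra => /eqP ->; rewrite ComplexField.Normc.normc0. Qed.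

Hypothesis gamma1 : forall j l, normc (gamma j l) = 1.

Lemma block_symbol_amalgam (kappa : R) (p q : \bar R) (A : 'rV[int]_(d + d) -> C) :
  (1 <= p)%E -> (1 <= q)%E -> (forall j, lambda j = 2 `^ (- (kappa * j%:R))) ->
  fine q^-1%E < kappa -> (forall k, normc (A k) = normc (block_symbol k)) ->
  amalgam p q (A \o @rV_floor R (d + d)).
Proof.
move=> p1 q1 lE qk AE.
have nE j l : normc ((lambda j)%:C * gamma j l) = 2 `^ (- (kappa * j%:R)).
  by rewrite ComplexField.Normc.normcM gamma1 mulr1 normc_real lE ger0_norm ?powR_ge0.
case: (exponentP q1) qk => [[-> ->] k0|[q' q'1 [-> ->]] k1].
  apply: (amalgam_cellwise_oo (M := 1)) => // k; rewrite AE.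
  have [->|/normc_block_symbol_neq0/block_symbol_neq0] := eqVneq (normc (block_symbol k)) 0 => //.
  move=> [j [l [_ _ ->]]]; rewrite nE -[leRHS](powRr0 2) ler_powR ?ler1n//.
  by rewrite oppr_le0 mulr_ge0// ltW.
have q'0 : 0 < q' by rewrite (lt_le_trans _ q'1).
apply: amalgam_cellwise_fin => //.
apply: (@esum_dyadic _ _ cell (fun k => normc (A k) `^ q') (kappa * q')).
- exact: block_cell_inj.
- by move=> k; exact: powR_ge0.
- by rewrite -ltr_pdivrMr// div1r.
- move=> k; rewrite AE => h; have {h} : normc (block_symbol k) != 0.
    by apply: contra h => /eqP ->; rewrite powR0// gt_eqF.
  move=> /normc_block_symbol_neq0/block_symbol_neq0[j [l [kE lj sE]]].
  exists j, l; split => //; rewrite sE nE -powRrM le_eqVlt; apply/orP; left.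
  by apply/eqP; congr (_ `^ _); ring.
Qed.

End symbols.

(** * Testing boundedness on one cell *)

Section locop_test.
Context {R : realType} {n : nat}.
Local Notation C := R[i].
Local Notation mu := (@lebesgue_rV R n).
Local Notation normc := ComplexField.Normc.normc.

(** [f] is charged at the exponent [r] and [g] at its conjugate, so a support of volume proportional
    to 1/N gains N^(-1/r) in the place of [f] and N^(1/r - 1) in the place of [g]. *)
Lemma locop_test (phi1 phi2 : 'rV[R]_n -> C) a (r s : \bar R) (c : R) (f g : 'rV[R]_n -> C)
    (k : 'rV[int]_n) (Bf Bg : set 'rV[R]_n) (Mf Mg Vf Vg : R) :
  (1 <= r)%E -> (1 <= s)%E -> 0 <= c ->
  (forall f, amalgam r s f -> exists h, [/\ amalgam r s h, is_locop phi1 phi2 a f h &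
      (amalgam_norm r s h <= c%:E * amalgam_norm r s f)%E]) ->
  cmeasurable f -> measurable Bf -> mu Bf = Vf%:E -> 0 <= Mf -> Bf `<=` unit_cube k ->
  (forall x, normc (f x) <= Mf * \1_Bf x) ->
  cmeasurable g -> cschwartz g -> measurable Bg -> mu Bg = Vg%:E -> 0 <= Mg ->
  Bg `<=` unit_cube k -> (forall x, normc (g x) <= Mg * \1_Bg x) ->
  complex.Re (locop_form phi1 phi2 a f g) <=
    Mg * Vg `^ (1 - fine r^-1%E) * (c * (Mf * Vf `^ fine r^-1%E)).
Proof.
move=> r1 s1 c0 bd mf mBf BfV Mf0 Bfk fB mg sg mBg BgV Mg0 Bgk gB.
have lf : (local_norm r f k <= (Mf * Vf `^ fine r^-1%E)%:E)%E.
  exact: (local_norm_le_bounded k r1 mf mBf BfV Mf0 fB).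
have af : (amalgam_norm r s f <= (Mf * Vf `^ fine r^-1%E)%:E)%E.
  apply: le_trans lf; apply: amalgam_norm_single => // x xk.
  have := fB x; rewrite indicE memNset ?mulr0; last by move/Bfk.
  by move=> h; apply: ComplexField.Normc.eq0_normc; apply/eqP; rewrite eq_le h normc_ge0.
have [|h [[mh hoo] hP hn]] := bd f; first by split => //; apply: le_lt_trans af _; exact: ltry.
rewrite -lee_fin -hP//.
have lh : (local_norm r h k <= (c * (Mf * Vf `^ fine r^-1%E))%:E)%E.
  apply: (le_trans (local_norm_le_amalgam _ _ _ s1)); apply: (le_trans hn).
  by rewrite EFinM lee_wpmul2l ?lee_fin.
apply: le_trans (Re_inner_le r1 mh mg mBg BgV Mg0 Bgk gB _) _.
  by apply: le_lt_trans lh _; exact: ltry.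
by rewrite [leRHS]EFinM lee_wpmul2l// lee_fin mulr_ge0// powR_ge0.
Qed.

Lemma powR2_unbounded (theta K : R) : 0 < theta ->
  exists j : nat, K < 2 `^ (theta * j%:R).
Proof.
move=> t0; have l2 : 0 < ln (2 : R) by rewrite ln_gt0// ltr1n.
have tl : 0 < theta * ln 2 by rewrite mulr_gt0.
exists (Num.Def.archi_bound (`|K| / (theta * ln 2))).
have := @archi_boundP R (`|K| / (theta * ln 2)).
rewrite divr_ge0 ?(ltW tl)// => /(_ isT); rewrite ltr_pdivrMr// => h.
rewrite /powR pnatr_eq0 /=; apply: (le_lt_trans (ler_norm K)); apply: (lt_le_trans h).
apply: le_trans (expR_ge1Dx _); rewrite -[leLHS]add0r lerD//.
by rewrite mulrCA mulrA.
Qed.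

End locop_test.

(** * The inequality between exponents *)

Section main.
Context {R : realType} {n : nat}.
Local Notation C := R[i].
Local Notation d := n.+1.
Local Notation normc := ComplexField.Normc.normc.

Variables (M rho delta : R) (chi1 chi2 : 'rV[R]_d -> R).
Hypotheses (M0 : 0 < M) (rho0 : 0 < rho) (delta0 : 0 < delta) (delta1 : delta < 1).
Hypotheses (b1 : is_window M rho delta chi1) (b2 : is_window M rho delta chi2).

Variables (L : R) (spacing : nat).
Hypotheses (L2 : 2 <= L) (L4 : 4 * rho <= L) (Lpi : 8 * pi * rho * d%:R <= L).
Hypothesis spacing_gt : rho + 2 < spacing%:R.

Let L0 : 0 < L. Proof. exact: lt_le_trans L2. Qed.

Let spacing0 : (0 < spacing)%N.
Proof. by rewrite -(ltr0n R); apply: lt_trans spacing_gt; rewrite addr_gt0. Qed.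

Let N0 j : (0 < 2 ^ j)%N. Proof. by rewrite expn_gt0. Qed.

Section orientation.
(* [chiu] is the window analysing the spike, [chiv] the one analysing the flat
   polynomial. *)
Variables (chiu chiv : 'rV[R]_d -> R).
Hypotheses (bu : is_window M rho delta chiu) (bv : is_window M rho delta chiv).
Variable kappa : R.

Let lambda (j : nat) : R := 2 `^ (- (kappa * j%:R)).

Lemma blocks_exist : exists gamma : nat -> nat -> C,
  forall j, [/\ forall l, normc (gamma j l) = 1,
    forall y, normc (trig_sum (2 ^ j) (gamma j) y) <= Num.sqrt (2 ^+ j.+1),
    cintegrable (block_integrand L spacing chi1 chiu chiv j (gamma j)) &
    block_const (n := n) delta L <= complex.Re (cintegral
      (block_integrand L spacing chi1 chiu chiv j (gamma j)))].
Proof.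
have H j : exists g : nat -> C, [/\ forall l, normc (g l) = 1,
    forall y, normc (trig_sum (2 ^ j) g y) <= Num.sqrt (2 ^+ j.+1),
    cintegrable (block_integrand L spacing chi1 chiu chiv j g) &
    block_const (n := n) delta L <= complex.Re (cintegral
      (block_integrand L spacing chi1 chiu chiv j g))].
  have [eps fe] : exists eps : nat -> R, flat j eps by exact: rudin_shapiro.
  have [i ilow] := block_lower spacing M0 rho0 delta0 delta1 L2 Lpi b1 bu bv fe.
  exists (twist j eps i); split => //.
  - by move=> l; exact: normc_twist fe.
  - by move=> y; exact: trig_sum_twist.
  - exact: (@cintegrable_block _ _ M rho delta L spacing M0 rho0 L2).
by have [gamma gP] := choice H; exists gamma.
Qed.

Variable gamma : nat -> nat -> C.
Local Notation U j z := (stft (fun t => (chiu t)%:C) (spike L spacing chi1 j) (lsubmx z) (rsubmx z)).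
Local Notation V j z := (stft (fun t => (chiv t)%:C) (polyphase L spacing chi1 j (gamma j)) (lsubmx z) (rsubmx z)).

(** On the cells of block [j] both sides agree term by term. On a cell of another block the
    transform of the spike vanishes by separation, and elsewhere the symbol is 0. *)
Lemma block_symbol_form j z :
  block_symbol spacing lambda gamma (rV_floor z) * U j z * conjc (V j z) =
  (lambda j)%:C * block_integrand L spacing chi1 chiu chiv j (gamma j) z.
Proof.
rewrite /block_integrand mulr_sumr.
have [[l [lj zl]]|nz] := pselect (exists l : nat, (l < 2 ^ j)%N /\ rV_floor z = block_cell spacing j l).
  rewrite zl block_symbol_cell// (bigD1 (Ordinal lj))//= big1 ?addr0.
    by rewrite indicE mem_set ?mulr1 ?mulrA// unit_cubeE.
  move=> m ml; rewrite indicE memNset ?mulr0 ?mul0r ?mulr0// unit_cubeE /= zl.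
  move=> /(block_cell_inj spacing0)[_ lm]; move/eqP: ml; apply; exact/ord_inj.
rewrite big1; last first.
  move=> m _; rewrite indicE memNset ?mulr0 ?mul0r ?mulr0// unit_cubeE /= => zm.
  by apply: nz; exists m.
have [->|] := eqVneq (block_symbol spacing lambda gamma (rV_floor z)) 0; first by rewrite !mul0r.
move=> /block_symbol_neq0[j' [l [zE lj _]]].
have jj' : j != j' by apply/eqP => jE; apply: nz; exists l; rewrite jE.
have : unit_cube (block_cell spacing j' l) z by rewrite unit_cubeE.
move=> /unit_cube_row[zl _].
rewrite /spike (@stft_wave_far _ _ M rho delta L spacing rho0 L2 L4 spacing_gt chi1 b1 j j' chiu
  _ _ _ z bu (N0 j) jj' zl).
by rewrite mulr0 mul0r.
Qed.

(** Only the real part of [F] is prescribed, because with the spike in the place of [g] the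
    integrand is the complex conjugate of the one for the block. *)
Lemma Re_block_form j (F : 'rV[R]_(d + d) -> C) :
  cintegrable (block_integrand L spacing chi1 chiu chiv j (gamma j)) ->
  (forall z, complex.Re (F z) = complex.Re
    (block_symbol spacing lambda gamma (rV_floor z) * U j z * conjc (V j z))) ->
  complex.Re (cintegral F) = lambda j * complex.Re (cintegral
    (block_integrand L spacing chi1 chiu chiv j (gamma j))).
Proof.
move=> [iB _] FE; rewrite /= -RintegralZl//; apply: eq_Rintegral => z _.
by rewrite FE block_symbol_form Re_real_mul.
Qed.

End orientation.

Local Notation W := ((2 * rho / L) ^+ d).

Lemma lebesgue_envelope_box j N : (0 < N)%N ->
  lebesgue_rV d (envelope_box rho (block_scale L N) (block_center spacing j)) = (W / N%:R)%:E.
Proof.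
move=> N_gt0; have s0 i : 0 < block_scale (n := n) L N i by exact: (block_scale_gt0 L2).
rewrite envelope_boxE//; congr _%:E.
exact: (block_scale_prod L2).
Qed.

Lemma powR_growth_compare (c0 K e kappa : R) : 0 < c0 ->
  (forall j : nat, 2 `^ (- (kappa * j%:R)) * c0 <=
    K * (2 `^ (j%:R / 2) * 2 `^ (- (e * j%:R)))) -> e - 2^-1 <= kappa.
Proof.
move=> c0_gt0 H; rewrite leNgt; apply/negP => ke.
have t0 : 0 < e - 2^-1 - kappa by rewrite subr_gt0.
have [j] := powR2_unbounded (K / c0) t0; apply/negP; rewrite -leNgt.
have P0 : 0 < 2 `^ (j%:R / 2 - e * j%:R) :> R by exact: powR_gt0.
rewrite ler_pdivlMr// -(ler_pM2r P0); have := H j.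
rewrite -powRD ?pnatr_eq0 ?implybT//; apply: le_trans.
rewrite mulrAC -powRD ?pnatr_eq0 ?implybT// le_eqVlt; apply/orP; left.
by apply/eqP; congr (_ `^ _ * _); field.
Qed.

Lemma sqrt_pow2 j : Num.sqrt (2 ^+ j.+1) = Num.sqrt 2 * 2 `^ (j%:R / 2) :> R.
Proof.
rewrite exprS sqrtrM//; congr (_ * _).
by rewrite -powR_mulrn// -powR12_sqrt ?powR_ge0// -powRrM.
Qed.

Lemma powR_div_pow2 (w e : R) j : 0 <= w ->
  (w / (2 ^ j)%:R) `^ e = w `^ e * 2 `^ (- (e * j%:R)).
Proof.
move=> w0; rewrite powRM ?invr_ge0//; congr (_ * _).
by rewrite natrX -powR_invn// -powRrM mulNr mulrC.
Qed.

Lemma locop_bounded_exponent (p q r s : \bar R) (kappa : R) :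
  (1 <= p)%E -> (1 <= q)%E -> (1 <= r)%E -> (1 <= s)%E ->
  (forall a : 'rV[R]_(d + d) -> C, amalgam p q a ->
    locop_bounded (fun t => (chi1 t)%:C) (fun t => (chi2 t)%:C) a r s) ->
  fine q^-1%E < kappa -> `|fine r^-1%E - 2^-1| <= kappa.
Proof.
move=> p1 q1 r1 s1 Hbd qk.
pose lambda (j : nat) : R := 2 `^ (- (kappa * j%:R)).
have W0 : 0 <= W by rewrite exprn_ge0// divr_ge0 ?mulr_ge0 ?ltW.
have s0 N i : (0 < N)%N -> 0 < block_scale (n := n) L N i by exact: (block_scale_gt0 L2).
have c0 := block_const_gt0 (n := n) delta0 L2.
have mB N j : measurable (envelope_box rho (block_scale (n := n) L N) (block_center spacing j)).
  exact: measurable_centered_box.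
have muB1 j : lebesgue_rV d (envelope_box rho (block_scale L 1) (block_center spacing j)) = W%:E.
  by rewrite lebesgue_envelope_box// divr1.
have muBj j := lebesgue_envelope_box j (N0 j).
have subB N j (N_gt0 : (0 < N)%N) := block_box_sub (n := n) L2 L4 (spacing := spacing) (j := j) N_gt0.
set ir := fine r^-1%E.
have spike_bound j t := @spike_le R n M rho delta L spacing M0 L2 chi1 b1 j t.
have Ms j : 0 <= M * Num.sqrt (2 ^+ j.+1) by rewrite mulr_ge0 ?sqrtr_ge0// ltW.
(* The spike is [f], with volume [W / 2 ^ j] at exponent [ir]; the polynomial is [g] and contributes
   the square root of [2 ^ j]. *)
have upper : ir - 2^-1 <= kappa.
  have [gamma gP] := blocks_exist b1 b2.
  have g1 j l : normc (gamma j l) = 1 by have [] := gP j.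
  (* All blocks sit in this one symbol, so [c] is fixed before [j] is. *)
  have [c cge0 bd] := Hbd _ (block_symbol_amalgam spacing0 g1 p1 q1
    (fun j => erefl (lambda j)) qk (fun k => erefl _)).
  apply: (@powR_growth_compare (block_const (n := n) delta L)
    (M * Num.sqrt 2 * W `^ (1 - ir) * (c * (M * W `^ ir)))) => // j.
  have [_ gsup gint glow] := gP j.
  have poly_bound t := @normc_wave_le R n M rho delta chi1 M0 b1 _
    (block_center spacing j) (fun i => s0 1%N i isT) _ _ _ gsup t.
  have := @locop_test R d _ _ _ r s c (spike L spacing chi1 j)
    (polyphase L spacing chi1 j (gamma j)) (axis_cell (spacing * j)) _ _ M _ _ _
    r1 s1 cge0 bd (cmeasurable_wave b1 _ _ _ _) (mB _ _) (muBj j) (ltW M0)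
    (subB _ _ (N0 j)) (spike_bound j) (cmeasurable_wave b1 _ _ _ _)
    (cschwartz_wave rho0 b1 _ (fun i => s0 1%N i isT) _ _) (mB _ _) (muB1 j) (Ms j)
    (subB 1%N j isT) poly_bound.
  rewrite [X in X <= _](_ : _ = lambda j * complex.Re (cintegral
    (block_integrand L spacing chi1 chi1 chi2 j (gamma j)))); last exact: Re_block_form.
  have lc : lambda j * block_const (n := n) delta L <= lambda j * complex.Re (cintegral
      (block_integrand L spacing chi1 chi1 chi2 j (gamma j))).
    by rewrite ler_wpM2l// powR_ge0.
  move=> /(le_trans lc) /le_trans; apply.
  rewrite -/ir powR_div_pow2// sqrt_pow2 le_eqVlt; apply/orP; left; apply/eqP; ring.
(* The roles are exchanged: the spike is [g], analysed by [chi2], and its volume enters at exponent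
   [1 - ir]. Conjugating the symbol makes the form the conjugate of the block form. *)
have lower : 1 - ir - 2^-1 <= kappa.
  have [gamma gP] := blocks_exist b2 b1.
  have g1 j l : normc (gamma j l) = 1 by have [] := gP j.
  have [c cge0 bd] := Hbd _ (block_symbol_amalgam spacing0 g1 p1 q1
    (fun j => erefl (lambda j)) qk
    (A := fun k => conjc (block_symbol spacing lambda gamma k)) (fun k => normc_conjc _)).
  apply: (@powR_growth_compare (block_const (n := n) delta L)
    (M * W `^ (1 - ir) * (c * (M * Num.sqrt 2 * W `^ ir)))) => // j.
  have [_ gsup gint glow] := gP j.
  have poly_bound t := @normc_wave_le R n M rho delta chi1 M0 b1 _
    (block_center spacing j) (fun i => s0 1%N i isT) _ _ _ gsup t.
  have := @locop_test R d _ _ _ r s c (polyphase L spacing chi1 j (gamma j))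
    (spike L spacing chi1 j) (axis_cell (spacing * j)) _ _ _ M _ _
    r1 s1 cge0 bd (cmeasurable_wave b1 _ _ _ _) (mB _ _) (muB1 j) (Ms j)
    (subB 1%N j isT) poly_bound (cmeasurable_wave b1 _ _ _ _)
    (cschwartz_wave rho0 b1 _ (fun i => s0 _ i (N0 j)) _ _) (mB _ _) (muBj j) (ltW M0)
    (subB _ _ (N0 j)) (spike_bound j).
  rewrite [X in X <= _](_ : _ = lambda j * complex.Re (cintegral
    (block_integrand L spacing chi1 chi2 chi1 j (gamma j)))); last first.
    apply: Re_block_form => // z; rewrite -[RHS]Re_conjc !conjc_mul conjcK.
    by rewrite mulrAC.
  have lc : lambda j * block_const (n := n) delta L <= lambda j * complex.Re (cintegral
      (block_integrand L spacing chi1 chi2 chi1 j (gamma j))).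
    by rewrite ler_wpM2l// powR_ge0.
  move=> /(le_trans lc) /le_trans; apply.
  rewrite -/ir powR_div_pow2// sqrt_pow2 le_eqVlt; apply/orP; left; apply/eqP; ring.
by rewrite ler_norml; apply/andP; split; lra.
Qed.

End main.

Theorem theorem5p4 (R : realType) (d : nat) (phi1 phi2 : 'rV[R]_d -> R[i])
    (p q r s : \bar R) :
  (1 <= d)%N ->
  Cc_infty phi1 -> Cc_infty phi2 ->
  phi1 0 = 1 -> phi2 0 = 1 ->
  (forall x, 0 <= phi1 x) -> (forall x, 0 <= phi2 x) ->
  (1 <= p)%E -> (1 <= q)%E -> (1 <= r)%E -> (1 <= s)%E ->
  (forall a : 'rV[R]_(d + d) -> R[i], amalgam p q a ->
    locop_bounded phi1 phi2 a r s) ->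
  (`|r^-1 - (2^-1)%:E| <= q^-1)%E.
Proof.
case: d phi1 phi2 => // n phi1 phi2 _ C1 C2 e1 e2 pos1 pos2 p1 q1 r1 s1.
have [-> [M1 [rho1 [delta1 [M1p rho1p delta1p w1]]]]] := Cc_infty_window C1 e1 pos1.
have [-> [M2 [rho2 [delta2 [M2p rho2p delta2p w2]]]]] := Cc_infty_window C2 e2 pos2.
pose M := M1 + M2; pose rho := rho1 + rho2.
(* The 1/2 keeps [delta] below 1, so that cores stay within their cells. *)
pose delta := Num.min 2^-1 (Num.min delta1 delta2).
have Mp : 0 < M by rewrite addr_gt0.
have rhop : 0 < rho by rewrite addr_gt0.
have deltap : 0 < delta by rewrite !lt_min delta1p delta2p invr_gt0 ltr0n.
have delta_lt1 : delta < 1 by rewrite gt_min invf_lt1// ltr1n.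
have b1 : is_window M rho delta (fun x => complex.Re (phi1 x)).
  apply: is_window_weaken w1; rewrite ?lerDl ?(ltW M2p) ?(ltW rho2p)//.
  by rewrite !ge_min lexx orbT.
have b2 : is_window M rho delta (fun x => complex.Re (phi2 x)).
  apply: is_window_weaken w2; rewrite ?lerDr ?(ltW M1p) ?(ltW rho1p)//.
  by rewrite !ge_min lexx !orbT.
move=> Hbd.
(* [L] will be [2 + 4 * rho + X]: 2 serves the lower bound on masses, [4 * rho] keeps envelopes
   within radius 1/4, and [X] keeps phases below 1/4. *)
pose X : R := 8 * pi * rho * n.+1%:R.
have X0 : 0 <= X by rewrite !mulr_ge0 ?pi_ge0 ?(ltW rhop).
have spacing_gt : rho + 2 < (Num.Def.archi_bound (rho + 2))%:R.
  by apply: archi_boundP; rewrite addr_ge0// ltW.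
have key kappa : fine q^-1%E < kappa -> `|fine r^-1%E - 2^-1| <= kappa.
  apply: (locop_bounded_exponent (L := 2 + 4 * rho + X) Mp rhop deltap delta_lt1 b1 b2
    _ _ _ spacing_gt p1 q1 r1 s1 Hbd).
  - by rewrite -addrA lerDl addr_ge0// mulr_ge0// ltW.
  - by rewrite addrAC lerDr addr_ge0.
  - by rewrite lerDr addr_ge0// mulr_ge0// ltW.
have fin (t : \bar R) : (1 <= t)%E -> t^-1%E = (fine t^-1%E)%:E.
  by case/exponentP => [[-> ->]|[t' t'1 [-> ->]]]; rewrite ?invey// inver gt_eqF// (lt_le_trans _ t'1).
rewrite (fin _ r1) (fin _ q1) -EFinB abse_EFin lee_fin.
(* Let [kappa] decrease to 1/q. *)
by apply/ler_addgt0Pr => e e0; apply: key; rewrite ltrDl.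
Qed.
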